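(* Let $q\in\mathbb C^*$ satisfy $q^n\neq1$ for all integers $n\ge1$, and let $A_q=\mathbb C\langle x^{\pm1},y^{\pm1}\rangle/(xy-qyx)$. The bijection $\omega:\bar{\mathcal C}^q\to\mathcal R^q$ from the (reduced) Calogero-Moser spaces to the set of isomorphism classes of right ideals of $A_q$ is equivariant under $\mathrm{Pic}(A_q)$. (The map $\omega$ and the actions of $\mathrm{Pic}(A_q)$ on $\bar{\mathcal C}^q$ and $\mathcal R^q$ are described in the context.)
   Context: Calogero-Moser spaces: for $n\ge1$, $\tilde{\mathcal C}^q_n$ is the space of quadruples $(X,Y,i,j)$ with $X,Y\in\mathrm{GL}_n(\mathbb C)$, $i\in\mathbb C^n$, $j\in\mathrm{Hom}(\mathbb C^n,\mathbb C)$, satisfying $qXY-YX+ij=0$; $\mathcal C_n^q$ is its quotient by the free action $g\cdot(X,Y,i,j)=(gXg^{-1},gYg^{-1},gi,jg^{-1})$ of $\mathrm{GL}_n(\mathbb C)$; $\mathcal C_0^q$ is a point. Equivalently (for $n\ge1$), $\mathcal C_n^q$ is the set of simultaneous conjugacy classes of pairs $(X,Y)\in\mathrm{GL}_n(\mathbb C)^2$ with $\mathrm{rk}(qXYX^{-1}Y^{-1}-1)=1$. $\mathbb Z^2$ acts by $(k,m):(X,Y)\mapsto(q^kX,q^mY)$; $\bar{\mathcal C}_n^q=\mathcal C_n^q/\mathbb Z^2$ and $\bar{\mathcal C}^q=\bigsqcup_{n\ge0}\bar{\mathcal C}^q_n$. Map $\omega$: $\mathcal R^q$ is the set of isomorphism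 classes of nonzero right ideals of $A_q$. Let $Q$ be the quotient skew-field of $A_q$. The bijection $\omega:\bar{\mathcal C}^q\to\mathcal R^q$ is induced by sending $(X,Y,i,j)$ to the class of the isomorphic fractional ideals $M_x=\det(X-x1)A_q+\kappa^{-1}\det(Y-y1)A_q$ and $M_y=\det(Y-y1)A_q+\kappa\det(X-x1)A_q$, where $\kappa=1+j(qY-y1)^{-1}(X-x1)^{-1}i$ and $\kappa^{-1}=1-j(X-qx1)^{-1}(Y-y1)^{-1}i$ in $Q$. Picard group: $\mathrm{Pic}(A_q)$ is the group of isomorphism classes of invertible $A_q$-bimodules symmetric over $\mathbb C$. The canonical map $\Omega:\mathrm{Aut}(A_q)\to\mathrm{Pic}(A_q)$, sending $\sigma$ to the class of $(A_q)^\sigma$ ($A_q$ as right module, left action twisted by $\sigma^{-1}$), is surjective with kernel the inner automorphisms. $\mathrm{Aut}(A_q)$ is identified with $(\mathbb C^* )^2\rtimes\mathrm{SL}_2(\mathbb Z)$, where $\begin{pmatrix}a&b\\c&d\end{pmatrix}$ acts on $(\mathbb C^* )^2$ by $(\alpha,\beta)\mapsto(\alpha^a\beta^b,\alpha^c\beta^d)$: $(\alpha,\beta)$ corresponds to $(x,y)\mapsto(\alpha x,\beta y)$, $g_1=\begin{pmatrix}1&1\\0&1\end{pmatrix}$ to $(x,y)\mapsto(yx,y)$, and $g_2=\begin{pmatrix}1&0\\-1&1\end{pmatrix}$ to $(x,y)\mapsto(x,yx^{-1})$. This gives $\mathrm{Pic}(A_q)\cong(\mathbb C^*/q^{\mathbb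 Z})^2\rtimes\mathrm{SL}_2(\mathbb Z)$. Action on $\bar{\mathcal C}^q$: $(\mathbb C^* )^2\rtimes\mathrm{SL}_2(\mathbb Z)$ acts on each $\mathcal C_n^q$ by $(\alpha,\beta):(X,Y)\mapsto(\alpha^{-1}X,\beta^{-1}Y)$, $g_1:(X,Y)\mapsto(Y^{-1}X,Y)$, $g_2:(X,Y)\mapsto(X,YX)$, and this induces an action of $\mathrm{Pic}(A_q)$ on each $\bar{\mathcal C}_n^q$ and hence on $\bar{\mathcal C}^q$. Action on $\mathcal R^q$: the natural action of $\mathrm{Pic}(A_q)$ on isomorphism classes of right ideals (rank one projective right modules), given by tensoring over $A_q$ with invertible bimodules; the stabilizer of $[M]$ consists of the classes of $P$ with $M\otimes_{A_q}P\cong M$. *)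

(* Defs.v *)
From HB Require Import structures.
From mathcomp Require Import all_boot all_order all_algebra.
From mathcomp Require Import generic_quotient boolp classical_sets reals complex.

Set Implicit Arguments.
Unset Strict Implicit.
Unset Printing Implicit Defensive.
#[local] Obligation Tactic := idtac.

Import Order.TTheory GRing.Theory Num.Theory.
Local Open Scope ring_scope.
Local Open Scope quotient_scope.

(* The presentation C<x^{+-1}, y^{+-1}>/(xy - qyx), as a universal property;
   it determines (A, x, y) up to unique isomorphism.  Taking unitAlgType rather
   than algType is no restriction: classically every algebra is one. *)
Record quantum_torus (K : fieldType) (q : K) (A : unitAlgType K) (x y : A) :
    Prop := QuantumTorus {
  qt_unit_x : x \is a GRing.unit;
  qt_unit_y : y \is a GRing.unit;
  qt_comm : x * y = q *: (y * x);
  qt_univ : forall (B : unitAlgType K) (u v : B),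
    u \is a GRing.unit -> v \is a GRing.unit -> u * v = q *: (v * u) ->
    exists f : {lrmorphism A -> B},
      [/\ f x = u, f y = v
        & forall g : {lrmorphism A -> B}, g x = u -> g y = v -> g =1 f] }.

(* Q is the quotient skew-field of A, along the embedding iota. *)
Record quotient_skewfield (A : nzRingType) (Q : unitRingType)
    (iota : {rmorphism A -> Q}) : Prop := QuotientSkewfield {
  qsf_inj : injective iota;
  qsf_skewfield : forall z : Q, z != 0 -> z \is a GRing.unit;
  qsf_frac : forall z : Q, exists a b : A, b != 0 /\ z = iota a / iota b }.

(* Right A-modules are left modules over the converse ring A^c, so that
   (a : A^c) *: m stands for m.a; the right module A is the regular module
   (A^c)^o, and its submodules are the right ideals. *)

Section Submodules.
Variables (S : nzRingType) (V : lmodType S).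

(* Not the library's submodClosed: universe constraints exclude quotients of it. *)
Record submodule := Submodule {
  submod_pred : V -> bool;
  submod_predP : submod_closed (submod_pred : {pred V}) }.

HB.instance Definition _ (U : submodule) :=
  GRing.isSubmodClosed.Build S V (submod_pred U) (submod_predP U).

Definition submod_of (U : submodule) := {v : V | v \in submod_pred U}.
HB.instance Definition _ U := SubChoice.on (submod_of U).
HB.instance Definition _ U := [SubChoice_isSubLmodule of submod_of U by <:].

(* u.S + v.S *)
Definition span2_pred (u v : V) : {pred V} :=
  fun w => `[< exists a b : S, w = a *: u + b *: v >].

Lemma span2_closed u v : submod_closed (span2_pred u v).
Proof.
split; first by apply/asboolP; exists 0, 0; rewrite !scale0r addr0.
move=> c w w' /asboolP[a [b ->]] /asboolP[a' [b' ->]]; apply/asboolP.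
exists (c * a + a'), (c * b + b').
by rewrite scalerDr !scalerDl !scalerA addrACA.
Qed.

Definition span2 (u v : V) : submodule := Submodule (span2_closed u v).

End Submodules.

Definition lmod_iso (S : nzRingType) (M N : lmodType S) : Prop :=
  exists f : {linear M -> N}, bijective f.

Lemma lmod_iso_refl (S : nzRingType) (M : lmodType S) : lmod_iso M M.
Proof. by exists idfun; exists id. Qed.

Lemma lmod_iso_sym (S : nzRingType) (M N : lmodType S) :
  lmod_iso M N -> lmod_iso N M.
Proof.
case=> f [g fK gK].
have glin : linear g by exact: can2_linear fK gK.
pose mx := GRing.isLinear.Build S N M *:%R g glin.
pose gl : {linear N -> M} := HB.pack g mx.
by exists gl; exists f.
Qed.

Lemma lmod_iso_trans (S : nzRingType) (M N P : lmodType S) :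
  lmod_iso M N -> lmod_iso N P -> lmod_iso M P.
Proof. by move=> [f bf] [g bg]; exists (g \o f); exact: bij_comp. Qed.

Section RightIdeals.
Variable A : nzRingType.

Record nzideal := NzIdeal {
  ideal_set : submodule (A^c)^o;
  ideal_nz : exists2 a, a \in submod_pred ideal_set & a != 0 }.

HB.instance Definition _ := gen_eqMixin nzideal.
HB.instance Definition _ := gen_choiceMixin nzideal.

Definition ideal_mod (I : nzideal) : lmodType A^c := submod_of (ideal_set I).

Definition ideal_rel (I J : nzideal) : bool :=
  `[< lmod_iso (ideal_mod I) (ideal_mod J) >].

Lemma ideal_rel_equiv : equiv_class_of ideal_rel.
Proof.
split.
- by move=> I; apply/asboolP/lmod_iso_refl.
- by move=> I J; apply/asboolP/asboolP => /lmod_iso_sym.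
- move=> J I K /asboolP h /asboolP h'.
  by apply/asboolP/(lmod_iso_trans h h').
Qed.

Canonical ideal_equiv := EquivRelPack ideal_rel_equiv.

(* The set R^q of isomorphism classes of nonzero right ideals. *)
Definition Rcal := {eq_quot ideal_rel}.
HB.instance Definition _ := Choice.on Rcal.

Lemma unit_ideal_nz :
  exists2 a, a \in submod_pred (span2 (1 : (A^c)^o) 0) & a != 0.
Proof.
exists 1; last exact: oner_neq0.
by apply/asboolP; exists 1, 0; rewrite scale1r scaler0 addr0.
Qed.

(* The class of the right ideals isomorphic to M (meaningful when there is a
   nonzero one; the class of A otherwise). *)
Definition class_of_module (M : lmodType A^c) : Rcal :=
  xget (\pi_Rcal (NzIdeal unit_ideal_nz))
       [set r | lmod_iso M (ideal_mod (repr r))].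

End RightIdeals.

Section Bimodules.
Variables (K : fieldType) (A : unitAlgType K).

(* A-bimodules symmetric over the ground field. *)
Record bimodule := Bimodule {
  bimod_right :> lmodType A^c;
  lact : A -> bimod_right -> bimod_right;
  lactDl : forall a b p, lact (a + b) p = lact a p + lact b p;
  lactDr : forall a p r, lact a (p + r) = lact a p + lact a r;
  lact1 : forall p, lact 1 p = p;
  lactM : forall a b p, lact (a * b) p = lact a (lact b p);
  lactC : forall a b p, lact a ((b : A^c) *: p) = (b : A^c) *: lact a p;
  lact_sym : forall (k : K) p, lact k%:A p = (k%:A : A^c) *: p }.

Definition bimod_iso (P P' : bimodule) : Prop :=
  exists f : {linear P -> P'},
    bijective f /\ forall a p, f (lact a p) = lact a (f p).

Definition balanced (M : lmodType A^c) (P : bimodule) (W : zmodType)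
    (b : M -> P -> W) : Prop :=
  [/\ forall m m' p, b (m + m') p = b m p + b m' p,
      forall m p p', b m (p + p') = b m p + b m p'
    & forall m a p, b ((a : A^c) *: m) p = b m (lact a p)].

(* T, with the map tau, is the right A-module M (x)_A P. *)
Definition is_tensor (M : lmodType A^c) (P : bimodule) (T : lmodType A^c)
    (tau : M -> P -> T) : Prop :=
  [/\ balanced tau,
      forall m p (a : A^c), tau m (a *: p) = a *: tau m p
    & forall (W : zmodType) (b : M -> P -> W), balanced b ->
        exists f : {additive T -> W},
          (forall m p, f (tau m p) = b m p) /\
          (forall f' : {additive T -> W},
             (forall m p, f' (tau m p) = b m p) -> f' =1 f)].

(* T, with the map tau, is the bimodule P (x)_A P'. *)
Definition is_bitensor (P P' T : bimodule) (tau : P -> P' -> T) : Prop :=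
  is_tensor tau /\ forall a p p', tau (lact a p) p' = lact a (tau p p').

Record automorphism := Automorphism {
  aut_fun :> {lrmorphism A -> A};
  aut_inv : {lrmorphism A -> A};
  aut_funK : cancel aut_fun aut_inv;
  aut_invK : cancel aut_inv aut_fun }.

Definition id_aut : automorphism :=
  @Automorphism idfun idfun (fun _ => erefl) (fun _ => erefl).

Lemma regular_rscaleE (a : A) (p : (A^c)^o) :
  (a : A^c) *: p = (p : A) * a :> A.
Proof. by []. Qed.

(* The bimodule A^s: left action twisted by the inverse of s. *)
Program Definition twist (s : automorphism) : bimodule :=
  @Bimodule (A^c)^o (fun (a : A) (p : A) => aut_inv s a * p) _ _ _ _ _ _.
Next Obligation. by move=> s a b p /=; rewrite rmorphD mulrDl. Qed.
Next Obligation. by move=> s a p r /=; rewrite mulrDr. Qed.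
Next Obligation. by move=> s p /=; rewrite rmorph1 mul1r. Qed.
Next Obligation. by move=> s a b p /=; rewrite rmorphM mulrA. Qed.
Next Obligation. by move=> s a b p; rewrite !regular_rscaleE mulrA. Qed.
Next Obligation.
move=> s k p; rewrite regular_rscaleE linearZ /= rmorph1.
by rewrite -scalerAl -scalerAr mul1r mulr1.
Qed.

Definition inverse_bimod (P P' : bimodule) : Prop :=
  (exists tau : P -> P' -> twist id_aut, is_bitensor tau) /\
  (exists tau : P' -> P -> twist id_aut, is_bitensor tau).

Definition invertible_bimod (P : bimodule) : Prop :=
  exists P', inverse_bimod P P'.

(* "r' = [P].r" for the left action [P].[M] = [M (x)_A P^{-1}] of Pic(A) on
   isomorphism classes of right ideals.  The inverse is what makes it a left
   action: M (x)_A (P (x)_A P')^{-1} is (M (x)_A P'^{-1}) (x)_A P^{-1}.  As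
   M (x)_A A^s is isomorphic to s^{-1}(M), the class of A^s sends [M] to
   [s(M)]. *)
Definition pic_act_R (P : bimodule) (r r' : Rcal A) : Prop :=
  exists P', inverse_bimod P P' /\
    exists tau : ideal_mod (repr r) -> P' -> ideal_mod (repr r'),
      is_tensor tau.

End Bimodules.

Section SemidirectProduct.
Variable K : fieldType.

(* (K^* )^2 ><| SL_2(Z) *)
Record torus_sl2 := TorusSL2 {
  ts_alpha : K;
  ts_beta : K;
  ts_mx : 'M[int]_2;
  ts_alpha_neq0 : ts_alpha != 0;
  ts_beta_neq0 : ts_beta != 0;
  ts_det : \det ts_mx = 1 }.

Program Definition ts_mul (g h : torus_sl2) : torus_sl2 :=
  let M := ts_mx g in
  @TorusSL2
    (ts_alpha g * (ts_alpha h ^ M 0 0 * ts_beta h ^ M 0 1))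
    (ts_beta g * (ts_alpha h ^ M 1 0 * ts_beta h ^ M 1 1))
    (M *m ts_mx h) _ _ _.
Next Obligation.
by move=> g h M; rewrite !mulf_neq0 ?expfz_neq0 ?ts_alpha_neq0 ?ts_beta_neq0.
Qed.
Next Obligation.
by move=> g h M; rewrite !mulf_neq0 ?expfz_neq0 ?ts_alpha_neq0 ?ts_beta_neq0.
Qed.
Next Obligation. by move=> g h M; rewrite det_mulmx !ts_det mul1r. Qed.

Definition ts_torus (a b : K) (ha : a != 0) (hb : b != 0) : torus_sl2 :=
  TorusSL2 ha hb (det1 int 2).

Definition ts_one : torus_sl2 := ts_torus (oner_neq0 K) (oner_neq0 K).

Definition mx2 (a b c d : int) : 'M[int]_2 :=
  \matrix_(i, j) if i == 0 then (if j == 0 then a else b)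
                 else (if j == 0 then c else d).

Lemma det_g1 : \det (mx2 1 1 0 1) = 1.
Proof.
by rewrite (expand_det_row _ 0) !big_ord_recl big_ord0 /cofactor !det_mx11 !mxE.
Qed.

Lemma det_g2 : \det (mx2 1 0 (-1) 1) = 1.
Proof.
by rewrite (expand_det_row _ 0) !big_ord_recl big_ord0 /cofactor !det_mx11 !mxE.
Qed.

Definition ts_g1 : torus_sl2 :=
  TorusSL2 (oner_neq0 K) (oner_neq0 K) det_g1.
Definition ts_g2 : torus_sl2 :=
  TorusSL2 (oner_neq0 K) (oner_neq0 K) det_g2.

End SemidirectProduct.

(* The identification of (C^* )^2 ><| SL_2(Z) with Aut(A).  With the given
   images of the generators, products correspond to composition in the order
   g first, then h: e.g. g_1 (alpha, beta) g_1^{-1} = (alpha beta, beta) holds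
   for this order only. *)
Record aut_identification (K : fieldType) (A : unitAlgType K) (x y : A)
    (phi : torus_sl2 K -> automorphism A) : Prop := AutIdentification {
  ai_mul : forall g h a, phi (ts_mul g h) a = phi h (phi g a);
  ai_torus : forall a b (ha : a != 0) (hb : b != 0),
    phi (ts_torus ha hb) x = a *: x /\ phi (ts_torus ha hb) y = b *: y;
  ai_g1 : phi (ts_g1 K) x = y * x /\ phi (ts_g1 K) y = y;
  ai_g2 : phi (ts_g2 K) x = x /\ phi (ts_g2 K) y = y / x }.

Section CalogeroMoser.
Variables (K : fieldType) (q : K).

(* For n = 0 there is exactly one such quadruple. *)
Record cmquad (n : nat) := CMQuad {
  cmX : 'M[K]_n;
  cmY : 'M[K]_n;
  cmi : 'cV[K]_n;
  cmj : 'rV[K]_n;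
  cmX_unit : cmX \in unitmx;
  cmY_unit : cmY \in unitmx;
  cm_eq : q *: (cmX *m cmY) - cmY *m cmX + cmi *m cmj = 0 }.

HB.instance Definition _ n := gen_eqMixin (cmquad n).
HB.instance Definition _ n := gen_choiceMixin (cmquad n).

Lemma cmquad_ext n (z z' : cmquad n) :
  cmX z = cmX z' -> cmY z = cmY z' -> cmi z = cmi z' -> cmj z = cmj z' ->
  z = z'.
Proof.
case: z z' => [X Y i j hX hY h] [X' Y' i' j' hX' hY' h'] /= eX eY ei ej.
subst; congr CMQuad; exact: Prop_irrelevance.
Qed.

Definition gauge_eq n (z z' : cmquad n) : Prop :=
  exists2 g : 'M[K]_n, g \in unitmx &
    [/\ cmX z' = g *m cmX z *m invmx g, cmY z' = g *m cmY z *m invmx g,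
        cmi z' = g *m cmi z & cmj z' = cmj z *m invmx g].

Definition gauge_rel n (z z' : cmquad n) : bool := `[< gauge_eq z z' >].

Lemma gauge_equiv n : equiv_class_of (@gauge_rel n).
Proof.
have gsym (z z' : cmquad n) : gauge_eq z z' -> gauge_eq z' z.
  case=> g ug [eX eY ei ej]; exists (invmx g); first by rewrite unitmx_inv.
  rewrite eX eY ei ej invmxK !mulmxA !mulVmx // !mul1mx.
  by rewrite -!mulmxA !mulVmx // !mulmx1.
split.
- move=> z; apply/asboolP; exists 1%:M; first exact: unitmx1.
  by rewrite invmx1 !mul1mx !mulmx1.
- by move=> z z'; apply/asboolP/asboolP => /gsym.
- move=> z' z z'' /asboolP[g ug [eX eY ei ej]] /asboolP[h uh [eX' eY' ei' ej']].
  apply/asboolP; exists (h *m g); first by rewrite unitmx_mul uh.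
  have -> : invmx (h *m g) = invmx g *m invmx h.
    have uhg : h *m g \in unitmx by rewrite unitmx_mul uh.
    rewrite -[RHS]mul1mx -(mulVmx uhg) -!mulmxA.
    by rewrite (mulmxA g) mulmxV // mul1mx mulmxV // mulmx1.
  by rewrite eX' eY' ei' ej' eX eY ei ej !mulmxA.
Qed.

Canonical gauge_equiv_rel n := EquivRelPack (@gauge_equiv n).

(* The Calogero-Moser space C_n^q. *)
Definition CM n := {eq_quot @gauge_rel n}.
HB.instance Definition _ n := Choice.on (CM n).

(* The maps (X, Y) |-> (aX, bY), (Y^{-1}X, Y), (X, YX), lifted to quadruples.
   Since ij = YX - qXY has rank one (when n > 0 and q is not a root of unity),
   (X, Y) determines (i, j) up to (li, l^{-1}j), hence the class of the
   quadruple, and any lift is the right one. *)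

Program Definition cm_scale (a b : K) (ha : a != 0) (hb : b != 0) n
    (z : cmquad n) : cmquad n :=
  @CMQuad n (a *: cmX z) (b *: cmY z) ((a * b) *: cmi z) (cmj z) _ _ _.
Next Obligation.
by move=> a b ha hb n z; rewrite unitmxZ ?unitfE // cmX_unit.
Qed.
Next Obligation.
by move=> a b ha hb n z; rewrite unitmxZ ?unitfE // cmY_unit.
Qed.
Next Obligation.
move=> a b ha hb n z.
rewrite -!scalemxAl -!scalemxAr !scalerA (mulrC b a) -mulrA (mulrC q).
rewrite -[(a * b * q) *: _]scalerA -scalerBr -scalerDr.
by rewrite cm_eq scaler0.
Qed.

Program Definition cm_g1 n (z : cmquad n) : cmquad n :=
  @CMQuad n (invmx (cmY z) *m cmX z) (cmY z) (invmx (cmY z) *m cmi z) (cmj z)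
    _ _ _.
Next Obligation.
by move=> n z; rewrite unitmx_mul unitmx_inv cmX_unit cmY_unit.
Qed.
Next Obligation. by move=> n z; exact: cmY_unit. Qed.
Next Obligation.
move=> n z; have uY := cmY_unit z.
have -> : cmY z *m (invmx (cmY z) *m cmX z)
        = invmx (cmY z) *m (cmY z *m cmX z).
  by rewrite !mulmxA mulmxV // mulVmx.
by rewrite -!mulmxA scalemxAr -mulmxBr -mulmxDr cm_eq mulmx0.
Qed.

Program Definition cm_g2 n (z : cmquad n) : cmquad n :=
  @CMQuad n (cmX z) (cmY z *m cmX z) (cmi z) (cmj z *m cmX z) _ _ _.
Next Obligation. by move=> n z; exact: cmX_unit. Qed.
Next Obligation. by move=> n z; rewrite unitmx_mul cmX_unit cmY_unit. Qed.
Next Obligation.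
by move=> n z; rewrite !mulmxA scalemxAl -mulmxBl -mulmxDl cm_eq mul0mx.
Qed.

(* The action of (C^* )^2 ><| SL_2(Z) on the spaces C_n^q; it is determined by
   its values on the generators, and products act in the same order as in
   aut_identification. *)
Record CM_action (act : forall n, torus_sl2 K -> CM n -> CM n) : Prop :=
    CMAction {
  ca_one : forall n c, @act n (ts_one K) c = c;
  ca_mul : forall n g h c, @act n (ts_mul g h) c = act n h (act n g c);
  ca_torus : forall n a b (ha : a != 0) (hb : b != 0) (z : cmquad n),
    act n (ts_torus ha hb) (\pi_(CM n) z)
    = \pi_(CM n) (cm_scale (invr_neq0 ha) (invr_neq0 hb) z);
  ca_g1 : forall n (z : cmquad n),
    act n (ts_g1 K) (\pi_(CM n) z) = \pi_(CM n) (cm_g1 z);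
  ca_g2 : forall n (z : cmquad n),
    act n (ts_g2 K) (\pi_(CM n) z) = \pi_(CM n) (cm_g2 z) }.

Hypothesis hq0 : q != 0.

(* (X, Y) |-> (q^k X, q^m Y) *)
Definition z2act n (k m : int) (c : CM n) : CM n :=
  \pi_(CM n) (cm_scale (expfz_neq0 k hq0) (expfz_neq0 m hq0) (repr c)).

Definition z2rel n (c c' : CM n) : bool :=
  `[< exists k m : int, c' = z2act k m c >].

Lemma z2act_pi n k m (z : cmquad n) : z2act k m (\pi_(CM n) z) =
  \pi_(CM n) (cm_scale (expfz_neq0 k hq0) (expfz_neq0 m hq0) z).
Proof.
rewrite /z2act; case: piP => z' /eqmodP /asboolP[g ug [eX eY ei ej]].
apply/esym/eqmodP/asboolP; exists g => //=.
by rewrite eX eY ei ej -!scalemxAr -!scalemxAl.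
Qed.

Lemma z2act_add n k m k' m' (c : CM n) :
  z2act k m (z2act k' m' c) = z2act (k + k') (m + m') c.
Proof.
elim/quotW: c => z.
rewrite (z2act_pi k' m' z) (z2act_pi k m) (z2act_pi _ _ z).
congr (\pi_(CM n) _).
by apply: cmquad_ext => //=; rewrite scalerA !expfzDr // mulrACA.
Qed.

Lemma z2act0 n (c : CM n) : z2act 0 0 c = c.
Proof.
elim/quotW: c => z; rewrite z2act_pi; congr (\pi_(CM n) _).
by apply: cmquad_ext => //=; rewrite !expr0z ?mulr1 scale1r.
Qed.

Lemma z2_equiv n : equiv_class_of (@z2rel n).
Proof.
have zsym (c c' : CM n) : z2rel c c' -> z2rel c' c.
  move=> /asboolP[k [m ->]]; apply/asboolP; exists (- k), (- m).
  by rewrite z2act_add !addNr z2act0.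
split.
- by move=> c; apply/asboolP; exists 0, 0; rewrite z2act0.
- by move=> c c'; apply/idP/idP; exact: zsym.
- move=> c' c c'' /asboolP[k [m ->]] /asboolP[k' [m' ->]].
  by apply/asboolP; exists (k' + k), (m' + m); rewrite z2act_add.
Qed.

Canonical z2_equiv_rel n := EquivRelPack (@z2_equiv n).

Definition CMbarn n := {eq_quot @z2rel n}.
HB.instance Definition _ n := Choice.on (CMbarn n).

(* The disjoint union over n >= 0 of the spaces C_n^q / Z^2. *)
Definition CMbar := {n : nat & CMbarn n}.

(* The action induced on the quotient by Z^2. *)
Definition act_bar (act : forall n, torus_sl2 K -> CM n -> CM n)
    (g : torus_sl2 K) (c : CMbar) : CMbar :=
  Tagged CMbarn (\pi_(CMbarn (tag c)) (act (tag c) g (repr (tagged c)))).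

End CalogeroMoser.

(* "c' = [P].c": the action of Pic(A) on CMbar deduced from that of
   (C^* )^2 ><| SL_2(Z) along g |-> [A^(phi g)]. *)
Definition pic_act_CM (K : fieldType) (q : K) (hq0 : q != 0)
    (A : unitAlgType K) (phi : torus_sl2 K -> automorphism A)
    (act : forall n, torus_sl2 K -> CM q n -> CM q n)
    (P : bimodule A) (c c' : CMbar hq0) : Prop :=
  exists g, bimod_iso P (twist (phi g)) /\ c' = act_bar act g c.

(* Q as a right A-module along iota. *)
Section FracModule.
Variables (A : nzRingType) (Q : unitRingType).

Definition frac_mod (iota : {rmorphism A -> Q}) : Type := Q.

Variable iota : {rmorphism A -> Q}.
HB.instance Definition _ := GRing.Zmodule.copy (frac_mod iota) Q.

Definition frac_scale (a : A^c) (z : frac_mod iota) : frac_mod iota :=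
  (z : Q) * iota a.

Lemma frac_scaleA a b z : frac_scale a (frac_scale b z) = frac_scale (a * b) z.
Proof. by rewrite /frac_scale -mulrA -rmorphM. Qed.

Lemma frac_scale1 : left_id 1 frac_scale.
Proof. by move=> z; rewrite /frac_scale rmorph1 mulr1. Qed.

Lemma frac_scaleDr : right_distributive frac_scale +%R.
Proof. by move=> a z z'; exact: mulrDl. Qed.

Lemma frac_scaleDl z : {morph frac_scale^~ z : a b / a + b}.
Proof. by move=> a b; rewrite /frac_scale rmorphD mulrDr. Qed.

HB.instance Definition _ := GRing.Zmodule_isLmodule.Build A^c (frac_mod iota)
  frac_scaleA frac_scale1 frac_scaleDr frac_scaleDl.

End FracModule.

(* The two-sided inverse of a square matrix over a noncommutative ring, when
   there is one. *)
Definition nc_invmx (S : nzRingType) n (M : 'M[S]_n) : 'M[S]_n :=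
  xget 0 [set N | M *m N = 1%:M /\ N *m M = 1%:M].

Section Omega.
Variables (K : fieldType) (q : K) (hq0 : q != 0).
Variables (A : unitAlgType K) (x y : A).
Variables (Q : unitRingType) (iota : {rmorphism A -> Q}).

(* The entries of M - t1 commute, so that the Leibniz formula \det is the
   determinant in the commutative ring K[t]. *)
Definition det_shift n (M : 'M[K]_n) (t : A) : A :=
  \det (map_mx (in_alg A) M - t%:M).

Definition toQ m n (M : 'M[K]_(m, n)) : 'M[Q]_(m, n) :=
  map_mx (iota \o in_alg A) M.

(* Its inverse in Q is 1 - j (X - qx1)^{-1} (Y - y1)^{-1} i. *)
Definition kappa n (z : cmquad q n) : Q :=
  1 + (toQ (cmj z)
       *m nc_invmx (toQ (q *: cmY z) - (iota y)%:M)
       *m nc_invmx (toQ (cmX z) - (iota x)%:M)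
       *m toQ (cmi z)) 0 0.

(* M_x = det(X - x1) A + kappa^{-1} det(Y - y1) A, inside Q. *)
Definition cm_module n (z : cmquad q n) : @submodule A^c (frac_mod iota) :=
  @span2 A^c (frac_mod iota)
    (iota (det_shift (cmX z) x))
    ((kappa z)^-1 * iota (det_shift (cmY z) y)).

(* The class of M_x does not depend on the representative used here. *)
Definition omega (c : CMbar hq0) : Rcal A :=
  class_of_module (submod_of (cm_module (repr (repr (tagged c))))).

End Omega.

(* Main.v *)
Require Import Defs.
From HB Require Import structures.
From mathcomp Require Import all_boot all_order all_algebra.
From mathcomp Require Import boolp classical_sets reals complex.
From mathcomp Require Import generic_quotient zify.

Set Implicit Arguments.
Unset Strict Implicit.
Unset Printing Implicit Defensive.

Import Order.TTheory GRing.Theory Num.Theory.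
Local Open Scope ring_scope.

(* The fractional ideal M_x is C(x)A /\ kappa^{-1} C(y)A: an element of the
   right-hand side is, modulo M_x, killed by a polynomial in x and by one in y,
   so it generates a finite-dimensional A-module, which is 0 as q is not a root
   of unity.  Comparing such modules thus amounts to comparing kappas.

   With U = (X - x)(qY - y) and W = U + ij = (Y - y)(X - qx), one has
   kappa = 1 + j U^{-1} i and kappa^{-1} = 1 - j W^{-1} i.  For a generator s of
   (C^* )^2 ><| SL_2(Z) sending (x, y) to (x', y'), the two kappas k, k' at
   (x', y', z) and (x, y, s z) are compared by the resolvent identity; e.g.
   for g_1, which maps x to w = yx,
   k'^{-1} k = 1 - j (X - qxY)^{-1} x (X - w)^{-1} i,
   and left multiplication by it maps s(M_z) onto M_{sz}; for g_2 one replaces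
   s(M_z) by x^{-1} s(M_z) first.  Invariance under Z^2 holds because (q^k, q^m) is inner. *)

(** Three obstacles shape the argument. An automorphism s is given on A only, whereas M_x lies in Q.
    So kappa is studied for an arbitrary generating pair (u, v), and s is applied only to an ideal
    of A isomorphic to M_x, whose generators are polynomial expressions in u and v. This turns M_x
    at (x, y) into the same formula at (s x, s y) and leaves a comparison of two pairs inside Q. The
    action on C_n^q is given on generators only, so the property carried through the induction must
    pass to products and inverses. It is the existence of an s-semilinear bijection, and such a
    bijection already exhibits its target as the tensor product of its source with the inverse of
    A^s. Finally [omega] chooses representatives of a gauge orbit, of a Z^2-orbit and of a class of
    ideals; each choice is absorbed by an isomorphism of modules. *)

(** * Subalgebras, with their own units *)

Section Subalgebras.
Variables (K : fieldType) (A : unitAlgType K).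

Record subalgebra := Subalgebra {
  subalg_pred : A -> bool;
  subalg_predP : subalg_closed (subalg_pred : {pred A}) }.

HB.instance Definition _ (S : subalgebra) :=
  GRing.isSubalgClosed.Build K A (subalg_pred S)
    (GRing.subalg_closed_semi (subalg_predP S)).

Definition subalg_of (S : subalgebra) := {a : A | a \in subalg_pred S}.
HB.instance Definition _ S := SubChoice.on (subalg_of S).
HB.instance Definition _ S := [SubChoice_isSubAlgebra of subalg_of S by <:].

Definition subalg_val S : subalg_of S -> A := \val.
HB.instance Definition _ S :=
  GRing.RMorphism.copy (@subalg_val S) (\val : subalg_of S -> A).
HB.instance Definition _ S :=
  GRing.Linear.copy (@subalg_val S) (\val : subalg_of S -> A).

Section Inverses.
Variable S : subalgebra.
Implicit Types a b : subalg_of S.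

(** [qt_univ] maps only into algebras with an inverse operation. A subalgebra need not be closed
    under inversion, so its units are the elements whose inverse stays inside. *)
Definition subalg_unit : pred (subalg_of S) :=
  fun a => `[< exists b, b * a = 1 /\ a * b = 1 >].

Definition subalg_inv a : subalg_of S :=
  xget a [set b | b * a = 1 /\ a * b = 1].

Lemma subalg_invP a : subalg_unit a ->
  subalg_inv a * a = 1 /\ a * subalg_inv a = 1.
Proof. by case/asboolP=> b hb; rewrite /subalg_inv;
  case: xgetP => [c _ //|/(_ b)]. Qed.

Lemma subalg_mulVr : {in subalg_unit, left_inverse 1 subalg_inv *%R}.
Proof. by move=> a /subalg_invP[]. Qed.

Lemma subalg_divrr : {in subalg_unit, right_inverse 1 subalg_inv *%R}.
Proof. by move=> a /subalg_invP[]. Qed.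

Lemma subalg_unitP a b : b * a = 1 /\ a * b = 1 -> subalg_unit a.
Proof. by move=> h; apply/asboolP; exists b. Qed.

Lemma subalg_inv_out : {in [predC subalg_unit], subalg_inv =1 id}.
Proof.
move=> a /negP hN; apply: xgetPN => b hb; apply: hN; exact: subalg_unitP hb.
Qed.

HB.instance Definition _ := GRing.NzRing_hasMulInverse.Build (subalg_of S)
  subalg_mulVr subalg_divrr subalg_unitP subalg_inv_out.

End Inverses.
End Subalgebras.

(** * Generation of the quantum torus *)

Section Generators.
Variables (K : fieldType) (A : unitAlgType K).

(** Stands in for the universal property: generation passes directly to (y, x), to conjugates, to
    rescalings and to images under automorphisms. *)
Record quantum_gen (q : K) (x y : A) : Prop := QuantumGen {
  qg_unit_x : x \is a GRing.unit;
  qg_unit_y : y \is a GRing.unit;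
  qg_comm : x * y = q *: (y * x);
  qg_ind : forall S : A -> Prop,
    S 1 -> (forall k a b, S a -> S b -> S (k *: a + b)) ->
    (forall a b, S a -> S b -> S (a * b)) ->
    S x -> S x^-1 -> S y -> S y^-1 -> forall a, S a }.

(** The universal map from A to the subalgebra cut out by [S], followed by the inclusion, fixes [x]
    and [y]. By uniqueness it is the identity, so the subalgebra is all of A. *)
Lemma quantum_torus_gen q x y : quantum_torus q x y -> quantum_gen q x y.
Proof.
case=> ux uy xy univ; split=> // S S1 SD SM Sx SxV Sy SyV a.
have Scl : subalg_closed ((fun a => `[< S a >]) : {pred A}).
  split; first exact/asboolP.
  - by move=> k b c /asboolP hb /asboolP hc; apply/asboolP/SD.
  - by move=> b c /asboolP hb /asboolP hc; apply/asboolP/SM.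
pose T := Subalgebra Scl.
have inT (b : A) (hb : S b) : b \in subalg_pred T by exact/asboolP.
pose mk b hb : subalg_of T := exist _ b (inT b hb).
have unit_mk b (ub : b \is a GRing.unit) (hb : S b) (hbV : S b^-1) :
    mk b hb \is a GRing.unit.
  apply/unitrP; exists (mk _ hbV).
  by split; apply: val_inj; [exact: mulVr | exact: mulrV].
have cT : mk x Sx * mk y Sy = q *: (mk y Sy * mk x Sx).
  exact: val_inj.
have [f [fx fy _]] := univ _ _ _ (unit_mk _ ux _ SxV) (unit_mk _ uy _ SyV) cT.
have [g [_ _ gU]] := univ _ _ _ ux uy xy.
pose h : {lrmorphism A -> A} := @subalg_val _ _ T \o f.
have hx : h x = x by rewrite -[LHS]/(\val (f x)) fx.
have hy : h y = y by rewrite -[LHS]/(\val (f y)) fy.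
have hE : h a = a by rewrite (gU h) // -(gU idfun).
by rewrite -hE; apply/asboolP; exact: valP (f a).
Qed.

End Generators.

(** * Sets of polynomials stable under dilation *)

Section Dilation.
Variable K : fieldType.
Implicit Types f g : {poly K}.

Lemma coef_dilate c f i : (f \Po (c *: 'X))`_i = f`_i * c ^+ i.
Proof.
have -> : f \Po (c *: 'X) = \poly_(k < size f) (f`_k * c ^+ k).
  rewrite comp_polyE poly_def; apply: eq_bigr => k _.
  by rewrite exprZn scalerA.
rewrite coef_poly; case: ltnP => // h; by rewrite nth_default // mul0r.
Qed.

Lemma dilate_neq0 c f : c != 0 -> f != 0 -> f \Po (c *: 'X) != 0.
Proof.
move=> c0 f0; apply/eqP => /(congr1 (fun g => g`_(size f).-1)).
rewrite coef_dilate coef0 => /eqP; rewrite mulf_eq0 expf_eq0 (negbTE c0) andbF.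
by rewrite orbF -[_`_ _]/(lead_coef f) lead_coef_eq0 (negbTE f0).
Qed.

(* Subtracting the dilated polynomial kills the constant term, and no other
   coefficient as q is not a root of unity. *)
Lemma dilation_ideal_full (q : K) (S : {poly K} -> Prop) :
  (forall n, (0 < n)%N -> q ^+ n != 1) ->
  (forall f g, S f -> S g -> S (f - g)) ->
  (forall c f, S f -> S (c *: f)) ->
  (forall f, S f -> S (f \Po (q *: 'X))) ->
  (forall f, S (f * 'X) -> S f) ->
  forall g, g != 0 -> S g -> S 1.
Proof.
move=> hq SB SZ Sq SX g; move: {2}(size g) (leqnn (size g)) => n.
elim: n g => [|n IH] g sg g0 Sg; first by case/negP: g0; rewrite -size_poly_leq0.
have step f : f`_0 = 0 -> f != 0 -> (size f <= n.+1)%N -> S f -> S 1.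
  move=> f00 f0 sf Sf.
  have : ('X - 0%:P) %| f by rewrite dvdp_XsubCl rootE horner_coef0 f00.
  rewrite subr0 => /dvdpP[h hE]; rewrite hE in f0 sf Sf.
  have h0 : h != 0 by apply: contraNneq f0 => ->; rewrite mul0r.
  by apply: (IH h) => //; [rewrite -ltnS -(size_mulX h0) | exact: SX].
case: (eqVneq g`_0 0) => [g00|g00]; first exact: (step g).
case: (leqP (size g) 1) => s1.
  have -> : 1 = (g`_0)^-1 *: g.
    by rewrite {2}(size1_polyC s1) -mul_polyC -polyCM mulVf.
  exact: SZ.
have sd : (0 < (size g).-1)%N by rewrite -ltnS prednK // (ltn_trans _ s1).
apply: (step (g - (g \Po (q *: 'X)))).
- by rewrite coefB coef_dilate expr0 mulr1 subrr.
- apply/eqP => /(congr1 (fun f => f`_(size g).-1)).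
  rewrite coefB coef_dilate coef0 -[X in X - _]mulr1 -mulrBr => /eqP.
  rewrite mulf_eq0 -[_`_ _]/(lead_coef g) lead_coef_eq0 (negbTE g0) /= subr_eq0.
  by rewrite eq_sym (negbTE (hq _ sd)).
- apply: leq_trans (size_polyD _ _) _; rewrite geq_max sg size_polyN.
  by apply/leq_sizeP => k hk; rewrite coef_dilate nth_default ?mul0r // (leq_trans sg).
- by apply: SB => //; exact: Sq.
Qed.

End Dilation.

(** * Polynomials in one generator: transcendence and the Ore condition *)

Section Evaluation.
Variables (K : fieldType) (A : unitAlgType K).
Implicit Types (f g h : {poly K}) (t u v x y : A).
Local Notation ev := horner_alg.

Lemma horner_alg_intertwine x u v f : x * u = u * v -> ev x f * u = u * ev v f.
Proof.
move=> xu; elim/poly_ind: f => [|f c IH]; first by rewrite !rmorph0 mul0r mulr0.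
rewrite !rmorphD !rmorphM /= !horner_algX !horner_algC mulrDl mulrDr.
by rewrite -mulrA xu mulrA IH -!mulrA -scalerAl -scalerAr mul1r mulr1.
Qed.

Lemma horner_alg_dilate c x f : ev (c *: x) f = ev x (f \Po (c *: 'X)).
Proof.
elim/poly_ind: f => [|f d IH]; first by rewrite comp_poly0 !rmorph0.
rewrite comp_polyD comp_polyM comp_polyX comp_polyC !rmorphD !rmorphM /=.
rewrite IH !horner_algX !horner_algC; congr (_ * _ + _).
by rewrite -mul_polyC rmorphM /= horner_algC horner_algX mulr_algl.
Qed.

Lemma horner_algZ c x f : ev x (c *: f) = c *: ev x f.
Proof. by rewrite -mul_polyC rmorphM /= horner_algC mulr_algl. Qed.

Lemma horner_alg_comm x f g : ev x f * ev x g = ev x g * ev x f.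
Proof. by rewrite -!rmorphM mulrC. Qed.

Section Transcendence.
Variables (q : K) (x y : A).
Hypotheses (q0 : q != 0) (hq : forall n, (0 < n)%N -> q ^+ n != 1).
Hypothesis xy : quantum_gen q x y.

Let uy := qg_unit_y xy.
Let ux := qg_unit_x xy.

Lemma quantum_gen_sym : quantum_gen q^-1 y x.
Proof.
split=> //; first by rewrite (qg_comm xy) scalerA mulVf // scale1r.
by move=> S *; apply: (qg_ind xy).
Qed.

Lemma quantum_commE : x * y = y * (q *: x).
Proof. by rewrite (qg_comm xy) scalerAr. Qed.

Lemma quantum_commVE : x * y^-1 = y^-1 * (q^-1 *: x).
Proof.
apply: (mulrI uy); rewrite mulVKr // mulrA.
have -> : y * x = q^-1 *: (x * y) by rewrite (qg_comm xy) scalerA mulVf // scale1r.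
by rewrite -scalerAl mulrK.
Qed.

(** Conjugation by [y] rescales [x] by [q], so the polynomials vanishing at [x] are stable under
    dilation; as [x] is a unit, they are also stable under division by X. A nonzero one would force
    1 = 0. *)
Lemma horner_alg_quantum_eq0 f : ev x f = 0 -> f = 0.
Proof.
move=> fx0; apply/eqP; apply: contraPT fx0 => f0 fx0.
suff : ev x 1 = 0 by move/eqP; rewrite rmorph1 oner_eq0.
apply: (dilation_ideal_full hq (S := fun f => ev x f = 0)) f0 fx0.
- by move=> g h g0 h0; rewrite rmorphB /= g0 h0 subr0.
- by move=> c g g0; rewrite horner_algZ g0 scaler0.
- move=> g g0; rewrite -horner_alg_dilate; apply: (mulrI uy).
  by rewrite -(horner_alg_intertwine _ quantum_commE) g0 mul0r mulr0.
- move=> g; rewrite rmorphM /= horner_algX => g0.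
  by apply: (mulIr ux); rewrite g0 mul0r.
Qed.

(* Ore condition for the powers of x, for which it suffices to treat the
   generators: the elements a as below form a subalgebra. *)
Lemma quantum_ore a h : h != 0 ->
  exists2 f, f != 0 & exists b, a * ev x f = ev x h * b.
Proof.
move: a h; apply: (qg_ind xy).
- by move=> h h0; exists h => //; exists 1; rewrite mulr1 mul1r.
- move=> k a b IHa IHb h h0.
  have [f f0 [c fE]] := IHa h h0; have [g g0 [d gE]] := IHb h h0.
  exists (f * g); first exact: mulf_neq0.
  exists (k *: (c * ev x g) + d * ev x f).
  rewrite mulrDl mulrDr -scalerAl -scalerAr rmorphM /= {2}horner_alg_comm.
  by rewrite (mulrA a) fE (mulrA b) gE !mulrA.
- move=> a b IHa IHb h h0; have [f f0 [c fE]] := IHa h h0.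
  have [g g0 [d gE]] := IHb f f0; exists g => //; exists (c * d).
  by rewrite -mulrA gE mulrA fE mulrA.
- by move=> h h0; exists h => //; exists x;
  rewrite -{1 4}(horner_algX x) horner_alg_comm.
- move=> h h0; exists h => //; exists x^-1; apply: (mulrI ux); apply: (mulIr ux).
  rewrite mulVKr // -!mulrA mulVr // mulr1.
  by rewrite -{2 3}(horner_algX x) horner_alg_comm.
- move=> h h0; exists (h \Po (q *: 'X)); first exact: dilate_neq0.
  by exists y; rewrite -horner_alg_dilate -(horner_alg_intertwine _ quantum_commE).
- move=> h h0; exists (h \Po (q^-1 *: 'X)); first by rewrite dilate_neq0 ?invr_eq0.
  by exists y^-1; rewrite -horner_alg_dilate -(horner_alg_intertwine _ quantum_commVE).
Qed.

End Transcendence.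
End Evaluation.

(** * Elements of Q with a denominator in one variable *)

Section Fractions.
Variables (K : fieldType) (A : unitAlgType K).
Variables (Q : unitRingType) (iota : {rmorphism A -> Q}).
Hypothesis hQ : quotient_skewfield iota.
Implicit Types (f g h : {poly K}) (t u v x y a b : A) (m : Q).
Local Notation ev := horner_alg.

(** Transcendence over [K], which makes nonzero polynomials in [t] invertible in Q. *)
Definition faithful t := forall f, ev t f = 0 -> f = 0.

Lemma iota_unit a : a != 0 -> iota a \is a GRing.unit.
Proof.
move=> a0; apply: (qsf_skewfield hQ); apply: contra a0 => /eqP.
by rewrite -(rmorph0 iota) => /(qsf_inj hQ) ->.
Qed.

Lemma horner_unit t h : faithful t -> h != 0 -> iota (ev t h) \is a GRing.unit.
Proof. by move=> ft h0; apply: iota_unit; apply: contra_neq h0 => /ft. Qed.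

(* m is in C(t) A *)
Definition ratl t m := exists2 h, h != 0 & exists a, iota (ev t h) * m = iota a.

Lemma ratl_iota t a : ratl t (iota a).
Proof. by exists 1; [exact: oner_neq0 | exists a; rewrite !rmorph1 mul1r]. Qed.

Lemma ratlD t m m' : ratl t m -> ratl t m' -> ratl t (m + m').
Proof.
case=> h h0 [a hE] [g g0 [b gE]]; exists (h * g); first exact: mulf_neq0.
exists (ev t g * a + ev t h * b); rewrite rmorphM /= mulrDr.
rewrite {1}horner_alg_comm !rmorphM /= rmorphD !rmorphM /=.
by rewrite -!mulrA hE gE.
Qed.

Lemma ratlN t m : ratl t m -> ratl t (- m).
Proof. by case=> h h0 [a hE]; exists h => //; exists (- a);
  rewrite mulrN hE rmorphN. Qed.

Lemma ratlMr t m a : ratl t m -> ratl t (m * iota a).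
Proof. by case=> h h0 [b hE]; exists h => //; exists (b * a);
  rewrite mulrA hE rmorphM. Qed.

Lemma ratlZ t c m : c != 0 -> ratl (c *: t) m <-> ratl t m.
Proof.
have aux d u : d != 0 -> ratl (d *: u) m -> ratl u m.
  move=> d0 [h h0 [a hE]]; exists (h \Po (d *: 'X)); first exact: dilate_neq0.
  by exists a; rewrite -horner_alg_dilate.
move=> c0; split; first exact: aux.
by move=> h; apply: (aux c^-1); rewrite ?invr_eq0 // scalerA mulVf // scale1r.
Qed.

Definition fracs : lmodType A^c := frac_mod iota.

Lemma memMr (N : submodule fracs) (m : Q) a :
  (m : fracs) \in submod_pred N -> (m * iota a : fracs) \in submod_pred N.
Proof. by move=> hm; exact: (rpredZ (a : A^c)). Qed.

Lemma memMrK (N : submodule fracs) (m : Q) a : a \is a GRing.unit ->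
  (m * iota a : fracs) \in submod_pred N -> (m : fracs) \in submod_pred N.
Proof.
by move=> ua /(memMr a^-1); rewrite -mulrA -rmorphM mulrV // rmorph1 mulr1.
Qed.

Lemma memZ (N : submodule fracs) (m : Q) (c : K) a :
  (m * iota a : fracs) \in submod_pred N ->
  (m * iota (c *: a) : fracs) \in submod_pred N.
Proof.
by move=> /(memMr c%:A); rewrite -mulrA -rmorphM mulr_algr.
Qed.

Lemma mem_span2 (m u v : Q) : (m : fracs) \in submod_pred (@span2 A^c fracs u v) <->
  exists a b, m = u * iota a + v * iota b.
Proof. by split=> [/asboolP|?]; last exact/asboolP. Qed.

End Fractions.

(** * Torsion modulo a submodule of Q *)

Section NoFiniteDimensional.
Variables (K : closedFieldType) (q : K) (A : unitAlgType K) (x y : A).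
Variables (Q : unitRingType) (iota : {rmorphism A -> Q}).
Hypotheses (q0 : q != 0) (hq : forall n, (0 < n)%N -> q ^+ n != 1).
Hypothesis xy : quantum_gen q x y.
Implicit Types (f g h : {poly K}) (a b : A) (m : Q).
Local Notation ev := horner_alg.
Local Notation fracs := (fracs iota).

(* The class of m in Q/N spans a finite-dimensional A-module; such a module
   is 0, because y maps the eigenspaces of x to eigenspaces for the distinct
   eigenvalues q^k lambda. *)
Lemma torsion_mem (N : submodule fracs) m f g : f != 0 -> g != 0 ->
  (m * iota (ev x f) : fracs) \in submod_pred N ->
  (m * iota (ev y g) : fracs) \in submod_pred N ->
  (m : fracs) \in submod_pred N.
Proof.
pose tor m := exists2 g, g != 0 & (m * iota (ev y g) : fracs) \in submod_pred N.
have q'0 : q^-1 != 0 by rewrite invr_eq0.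
have hq' n : (0 < n)%N -> q^-1 ^+ n != 1.
  by move=> n0; rewrite exprVn invr_eq1 hq.
have ux := qg_unit_x xy; have uy := qg_unit_y xy.
have yx := quantum_gen_sym q0 xy.
(* Modulo [N], v x = l v. If v g(y) is in [N], multiplying by [x] gives l v g(q^-1 y), so for
   nonzero l the annihilator of v in K[y] is stable under dilation and contains 1. For l = 0 the
   unit [x] already kills v. *)
have eigen l v : (v * iota (ev x ('X - l%:P)) : fracs) \in submod_pred N -> tor v ->
    (v : fracs) \in submod_pred N.
  rewrite rmorphB /= horner_algX horner_algC => hl [h h0 hh].
  case: (eqVneq l 0) => [l0|l0].
    by move: hl; rewrite l0 scale0r subr0; exact: memMrK.
  suff : (v * iota (ev y 1) : fracs) \in submod_pred N.
    by rewrite !rmorph1 mulr1.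
  apply: (dilation_ideal_full hq'
    (S := fun g => (v * iota (ev y g) : fracs) \in submod_pred N)) h0 hh.
  - move=> f1 g1 hf1 hg1; rewrite !rmorphB /= mulrBr; exact: rpredB.
  - by move=> c f1; rewrite horner_algZ; exact: memZ.
  - move=> f1 hf1; rewrite -horner_alg_dilate.
    rewrite -[ev _ f1](scalerK l0); apply: memZ.
    have -> : l *: ev (q^-1 *: y) f1 = ev y f1 * x - (x - l%:A) * ev (q^-1 *: y) f1.
      rewrite (horner_alg_intertwine _ (quantum_commE yx)) mulrBl mulr_algl.
      by rewrite opprB addrC subrK.
    rewrite rmorphB !rmorphM /= mulrBr !mulrA; apply: rpredB; first exact: memMr.
    exact: memMr.
  - by move=> f1; rewrite rmorphM /= horner_algX rmorphM mulrA; exact: memMrK.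
(* The Ore condition for [y] keeps the torsion hypothesis alive along the induction below. *)
have torx v l : tor v -> tor (v * iota (ev x ('X - l%:P))).
  case=> h h0 hv; have [f1 f10 [b bE]] := quantum_ore q'0 yx (ev x ('X - l%:P)) h0.
  by exists f1 => //; rewrite -mulrA -rmorphM bE rmorphM mulrA; exact: memMr.
move=> f0 g0 hf hg; have tm : tor m by exists g.
(* Over a closed field f splits, and its linear factors are removed one at a time by [eigen]. *)
have [s fE] := closed_field_poly_normal f.
move: hf; rewrite fE horner_algZ => /(memZ (lead_coef f)^-1).
rewrite scalerA mulVf ?lead_coef_eq0 // scale1r.
elim: s m tm {hg fE} => [|l s IH] v tv.
  by rewrite big_nil !rmorph1 mulr1.
rewrite big_cons !rmorphM /= mulrA => hv; apply: (eigen l) => //.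
by apply: IH hv; exact: torx.
Qed.

Hypothesis hQ : quotient_skewfield iota.

Lemma quantum_faithful : faithful x /\ faithful y.
Proof.
split=> f; first exact: (horner_alg_quantum_eq0 hq xy).
apply: (horner_alg_quantum_eq0 _ (quantum_gen_sym q0 xy)) => n n0.
by rewrite exprVn invr_eq1 hq.
Qed.

(** The Ore condition moves denominators to the right: h(x) m = a and a f(x) = h(x) p(x) c give m
    f(x) = p(x) c, which is in [N]. The same in [y] makes m torsion for both variables, so
    [torsion_mem] applies. *)
Lemma mem_span2_ratl (N : submodule fracs) p r k m : p != 0 -> r != 0 ->
  k \is a GRing.unit ->
  (iota (ev x p) : fracs) \in submod_pred N ->
  (k^-1 * iota (ev y r) : fracs) \in submod_pred N ->
  ratl iota x m -> ratl iota y (k * m) -> (m : fracs) \in submod_pred N.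
Proof.
move=> p0 r0 uk Np Nr [h h0 [a hE]] [g g0 [b gE]].
have [fx fy] := quantum_faithful.
have [f f0 [c fE]] := quantum_ore q0 xy a (mulf_neq0 h0 p0).
have q'0 : q^-1 != 0 by rewrite invr_eq0.
have [f' f'0 [c' fE']] := quantum_ore q'0 (quantum_gen_sym q0 xy) b (mulf_neq0 g0 r0).
apply: (torsion_mem f0 f'0).
  have -> : m * iota (ev x f) = iota (ev x p) * iota c.
    apply: (mulrI (horner_unit hQ fx h0)).
    by rewrite mulrA hE -(rmorphM iota a) fE !rmorphM /= !mulrA.
  exact: memMr.
have -> : m * iota (ev y f') = k^-1 * iota (ev y r) * iota c'.
  apply: (mulrI uk); apply: (mulrI (horner_unit hQ fy g0)).
  by rewrite !mulrA mulrK // -(mulrA _ k) gE -(rmorphM iota b) fE' !rmorphM.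
exact: memMr.
Qed.

End NoFiniteDimensional.

(** * Noncommutative matrix inverses and the resolvent identity *)

Section NoncommutativeInverse.
Variable S : nzRingType.

Definition nc_unitmx n (M : 'M[S]_n) := exists N, M *m N = 1%:M /\ N *m M = 1%:M.

Lemma nc_invmxP n (M : 'M[S]_n) : nc_unitmx M ->
  M *m nc_invmx M = 1%:M /\ nc_invmx M *m M = 1%:M.
Proof. by case=> N hN; rewrite /nc_invmx; case: xgetP => [N' _ //|/(_ N)]. Qed.

Lemma nc_mulmxV n (M : 'M[S]_n) : nc_unitmx M -> M *m nc_invmx M = 1%:M.
Proof. by case/nc_invmxP. Qed.

Lemma nc_mulVmx n (M : 'M[S]_n) : nc_unitmx M -> nc_invmx M *m M = 1%:M.
Proof. by case/nc_invmxP. Qed.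

Lemma nc_invmx_uniq n (M L R : 'M[S]_n) : M *m R = 1%:M -> L *m M = 1%:M ->
  nc_unitmx M /\ nc_invmx M = R.
Proof.
move=> MR LM; have LR : L = R by rewrite -[L]mulmx1 -MR mulmxA LM mul1mx.
have uM : nc_unitmx M by exists R; rewrite MR -LR LM.
by split=> //; rewrite -[RHS]mul1mx -(nc_mulVmx uM) -mulmxA MR mulmx1.
Qed.

Lemma nc_invmxM n (M N : 'M[S]_n) : nc_unitmx M -> nc_unitmx N ->
  nc_unitmx (M *m N) /\ nc_invmx (M *m N) = nc_invmx N *m nc_invmx M.
Proof.
move=> uM uN; apply: (@nc_invmx_uniq _ _ (nc_invmx N *m nc_invmx M)).
  by rewrite mulmxA -(mulmxA M) nc_mulmxV // mulmx1 nc_mulmxV.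
by rewrite mulmxA -(mulmxA _ _ M) nc_mulVmx // mulmx1 nc_mulVmx.
Qed.

Lemma entry_mul11 (M N : 'M[S]_1) : (M *m N) 0 0 = M 0 0 * N 0 0.
Proof. by rewrite mxE big_ord1. Qed.

Lemma entry_mul_scalar n (M : 'rV[S]_n) (N : 'cV[S]_n) c :
  (M *m (N *m c%:M)) 0 0 = (M *m N) 0 0 * c.
Proof. by rewrite mulmxA entry_mul11 [c%:M 0 0]mxE eqxx. Qed.

(* Sherman-Morrison, for two different matrices. *)
Lemma resolvent n (U1 U2 : 'M[S]_n) (i : 'cV_n) (j : 'rV_n) :
  nc_unitmx U1 -> nc_unitmx (U2 + i *m j) ->
  let E1 := nc_invmx U1 in let E2 := nc_invmx (U2 + i *m j) in
  (1 + (j *m E1 *m i) 0 0) * (1 - (j *m E2 *m i) 0 0)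
    = 1 + (j *m E1 *m (U2 - U1) *m E2 *m i) 0 0 /\
  (1 - (j *m E2 *m i) 0 0) * (1 + (j *m E1 *m i) 0 0)
    = 1 + (j *m E2 *m (U2 - U1) *m E1 *m i) 0 0.
Proof.
move=> u1 u2 E1 E2; set W := U2 + i *m j in u2 E2 *.
have -> : U2 - U1 = W - U1 - i *m j by rewrite /W addrAC addrK.
have c1 : E1 *m (W - U1 - i *m j) *m E2 = E1 - E2 - E1 *m i *m (j *m E2).
  rewrite !mulmxBr !mulmxBl -(mulmxA _ W) nc_mulmxV // nc_mulVmx //.
  by rewrite mulmx1 mul1mx !mulmxA.
have c2 : E2 *m (W - U1 - i *m j) *m E1 = E1 - E2 - E2 *m i *m (j *m E1).
  rewrite !mulmxBr !mulmxBl -(mulmxA _ U1) nc_mulmxV // nc_mulVmx //.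
  by rewrite mulmx1 mul1mx !mulmxA.
have e1 (M : 'M[S]_1) : 1 + M 0 0 = (1%:M + M) 0 0 by rewrite !mxE eqxx.
have e2 (M : 'M[S]_1) : 1 - M 0 0 = (1%:M - M) 0 0 by rewrite !mxE eqxx.
split; rewrite e1 e2 -entry_mul11 e1; congr (_ 0 0).
  have -> : j *m E1 *m (W - U1 - i *m j) *m E2 *m i
      = j *m (E1 *m (W - U1 - i *m j) *m E2) *m i by rewrite !mulmxA.
  rewrite c1 !mulmxBr !mulmxBl mulmx1 !mulmxA !mulmxDl mul1mx.
  by rewrite opprD !addrA.
have -> : j *m E2 *m (W - U1 - i *m j) *m E1 *m i
    = j *m (E2 *m (W - U1 - i *m j) *m E1) *m i by rewrite !mulmxA.
rewrite c2 !mulmxBr !mulmxBl !mulmxDr mulmx1 mul1mx mulmx1.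
by rewrite !mulmxA opprD -!addrA.
Qed.

End NoncommutativeInverse.

(** In [resolvent] with equal matrices the correction term vanishes. *)
Lemma resolvent_unit (S : unitRingType) n (U W : 'M[S]_n) (i : 'cV_n)
    (j : 'rV_n) k :
  nc_unitmx U -> nc_unitmx W -> U + i *m j = W ->
  k = 1 + (j *m nc_invmx U *m i) 0 0 ->
  k \is a GRing.unit /\ k^-1 = 1 - (j *m nc_invmx W *m i) 0 0.
Proof.
move=> uU uW WE kE; rewrite -{}WE in uW *.
have z0 : (0 : 'M[S]_1) 0 0 = 0 by rewrite mxE.
have [] := resolvent uU uW; rewrite -{}kE subrr !mulmx0 !mul0mx !z0 !addr0.
set kV := 1 - _ => kK Kk.
have uk : k \is a GRing.unit by apply/unitrP; exists kV.
by split=> //; apply: (mulrI uk); rewrite kK divrr.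
Qed.

(** The second factor in [resolvent] is the inverse of [k2], so that lemma computes both ratios.
    [D], [E1] and [E2] enter through equations, so that factored forms can be supplied, ready for
    cancellation. *)
Lemma resolvent_inv (S : unitRingType) n (U1 U2 W D E1 E2 : 'M[S]_n)
    (i : 'cV_n) (j : 'rV_n) (k1 k2 : S) :
  nc_unitmx U1 -> nc_unitmx U2 -> nc_unitmx W ->
  U2 + i *m j = W -> U2 - U1 = D -> nc_invmx U1 = E1 -> nc_invmx W = E2 ->
  k1 = 1 + (j *m nc_invmx U1 *m i) 0 0 ->
  k2 = 1 + (j *m nc_invmx U2 *m i) 0 0 ->
  [/\ k2 \is a GRing.unit,
      k2^-1 * k1 = 1 + (j *m E2 *m D *m E1 *m i) 0 0
    & k1 * k2^-1 = 1 + (j *m E1 *m D *m E2 *m i) 0 0].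
Proof.
move=> u1 u2 uW WE <- <- <- k1E k2E.
have [uk2 ->] := resolvent_unit u2 uW WE k2E; rewrite -{}WE in uW *.
by have [h1 h2] := resolvent u1 uW; rewrite -{}k1E in h1 h2; split.
Qed.

(** * Matrix pencils over A and over K[X] *)

Section LinearMatrices.
Variables (K : fieldType) (A : unitAlgType K).
Implicit Types (t u v : A).
Local Notation ev := horner_alg.

Definition toA m n (M : 'M[K]_(m, n)) : 'M[A]_(m, n) := map_mx (in_alg A) M.

Definition lin n t (M N : 'M[K]_n) : 'M[A]_n := toA M - t *: toA N.

Definition plin n (M N : 'M[K]_n) : 'M[{poly K}]_n :=
  map_mx polyC M - 'X *: map_mx polyC N.

Lemma toAM m n p (M : 'M[K]_(m, n)) (N : 'M[K]_(n, p)) :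
  toA (M *m N) = toA M *m toA N.
Proof. exact: map_mxM. Qed.

Lemma toAB m n (M N : 'M[K]_(m, n)) : toA (M - N) = toA M - toA N.
Proof. exact: map_mxB. Qed.

Lemma toA1 n : toA (1%:M : 'M[K]_n) = 1%:M.
Proof. exact: map_mx1. Qed.

Lemma toAZ m n c (M : 'M[K]_(m, n)) : toA (c *: M) = c%:A *: toA M.
Proof. by apply/matrixP=> i j; rewrite !mxE /= -scalerAl mul1r scalerA. Qed.

Lemma toA_scale m n p (M : 'M[K]_(m, n)) t (N : 'M[A]_(n, p)) :
  toA M *m (t *: N) = t *: (toA M *m N).
Proof.
apply/matrixP=> i j; rewrite !mxE big_distrr /=; apply: eq_bigr => k _.
by rewrite !mxE /= -!scalerAl !mul1r scalerAr.
Qed.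

Lemma toA_scalarC m n (M : 'M[K]_(m, n)) t : t%:M *m toA M = toA M *m t%:M.
Proof. by rewrite mul_scalar_mx -[t%:M]scalemx1 toA_scale mulmx1. Qed.

Lemma linM n t u (M N M' N' : 'M[K]_n) : lin t M N *m lin u M' N' =
  toA (M *m M') - u *: toA (M *m N') - t *: toA (N *m M')
    + (t * u) *: toA (N *m N').
Proof.
rewrite /lin mulmxBl !mulmxBr -!scalemxAl !toA_scale -!toAM scalerA opprB addrA.
by rewrite addrAC.
Qed.

Lemma lin_toA n t (M N C : 'M[K]_n) : lin t M N *m toA C = lin t (M *m C) (N *m C).
Proof. by rewrite /lin mulmxBl -scalemxAl !toAM. Qed.

Lemma toA_lin n t (M N C : 'M[K]_n) : toA C *m lin t M N = lin t (C *m M) (C *m N).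
Proof. by rewrite /lin mulmxBr toA_scale !toAM. Qed.

Lemma lin_horner n t (M N : 'M[K]_n) : lin t M N = map_mx (ev t) (plin M N).
Proof.
apply/matrixP=> i j; rewrite !mxE rmorphB rmorphM /= horner_algX !horner_algC.
by [].
Qed.

(** Its value at X = 0 is [\det M]. *)
Lemma det_plin_neq0 n (M N : 'M[K]_n) : M \in unitmx -> \det (plin M N) != 0.
Proof.
rewrite unitmxE unitfE; apply: contraNneq => d0.
have -> : M = map_mx (horner_eval 0) (plin M N).
  by apply/matrixP=> i j; rewrite !mxE /horner_eval !hornerE ?mul0r ?subr0.
by rewrite det_map_mx d0 rmorph0.
Qed.

Lemma det_plin_mull n (M N C : 'M[K]_n) :
  \det (plin (C *m M) (C *m N)) = (\det C)%:P * \det (plin M N).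
Proof.
rewrite -det_map_mx -det_mulmx; congr (\det _).
by rewrite /plin mulmxBr -scalemxAr !map_mxM.
Qed.

Lemma det_plin_mulr n (M N C : 'M[K]_n) :
  \det (plin (M *m C) (N *m C)) = \det (plin M N) * (\det C)%:P.
Proof.
rewrite -det_map_mx -det_mulmx; congr (\det _).
by rewrite /plin mulmxBl -scalemxAl !map_mxM.
Qed.

Lemma det_shiftE n (M : 'M[K]_n) t : det_shift M t = ev t (\det (plin M 1%:M)).
Proof.
by rewrite -det_map_mx -lin_horner /lin toA1 scalemx1.
Qed.

End LinearMatrices.

(** * Inverse pencils over Q and their denominators *)

Section QuotientMatrices.
Variables (K : fieldType) (A : unitAlgType K).
Variables (Q : unitRingType) (iota : {rmorphism A -> Q}).
Hypothesis hQ : quotient_skewfield iota.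
Implicit Types (t u v : A).
Local Notation ev := horner_alg.
Local Notation toQ := (toQ iota).
Local Notation iQ := (map_mx iota).

Lemma iQD m n (M N : 'M[A]_(m, n)) : iQ (M + N) = iQ M + iQ N.
Proof. exact: map_mxD. Qed.

Lemma iQB m n (M N : 'M[A]_(m, n)) : iQ (M - N) = iQ M - iQ N.
Proof. exact: map_mxB. Qed.

Lemma iQM m n p (M : 'M[A]_(m, n)) (N : 'M[A]_(n, p)) :
  iQ (M *m N) = iQ M *m iQ N.
Proof. exact: map_mxM. Qed.

Lemma iQ_scalar n a : iQ (a%:M : 'M[A]_n) = (iota a)%:M.
Proof. exact: map_scalar_mx. Qed.

Lemma toQE m n (M : 'M[K]_(m, n)) : toQ M = iQ (toA A M).
Proof. by apply/matrixP=> i j; rewrite !mxE. Qed.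

Lemma toQM m n p (M : 'M[K]_(m, n)) (N : 'M[K]_(n, p)) :
  toQ (M *m N) = toQ M *m toQ N.
Proof. by rewrite !toQE toAM map_mxM. Qed.

Lemma toQ_scalarC m n (M : 'M[K]_(m, n)) t :
  (iota t)%:M *m toQ M = toQ M *m (iota t)%:M.
Proof. by rewrite toQE -!map_scalar_mx -!map_mxM toA_scalarC. Qed.

Lemma toQ_unit n (M : 'M[K]_n) : M \in unitmx ->
  nc_unitmx (toQ M) /\ nc_invmx (toQ M) = toQ (invmx M).
Proof.
move=> uM; apply: (@nc_invmx_uniq _ _ _ (toQ (invmx M))).
  by rewrite -toQM mulmxV // /Defs.toQ map_mx1.
by rewrite -toQM mulVmx // /Defs.toQ map_mx1.
Qed.

Definition invlin n t (M N : 'M[K]_n) : 'M[Q]_n := nc_invmx (iQ (lin t M N)).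

Section Faithful.
Variable t : A.
Hypothesis ft : faithful t.
Variables (n : nat) (M N : 'M[K]_n).
Hypothesis uM : M \in unitmx.
Let d : Q := iota (ev t (\det (plin M N))).
Let adjQ : 'M[Q]_n := iQ (map_mx (ev t) (\adj (plin M N))).

Lemma det_lin_unit : d \is a GRing.unit.
Proof. by apply: horner_unit => //; exact: det_plin_neq0. Qed.

Lemma lin_adj : iQ (lin t M N) *m adjQ = d%:M /\ adjQ *m iQ (lin t M N) = d%:M.
Proof.
rewrite /adjQ lin_horner -!map_mxM mul_mx_adj mul_adj_mx.
by rewrite !map_scalar_mx.
Qed.

Lemma lin_unit : nc_unitmx (iQ (lin t M N)).
Proof.
have [DA AD] := lin_adj.
case: (@nc_invmx_uniq _ _ (iQ (lin t M N)) (d^-1%:M *m adjQ) (adjQ *m d^-1%:M)) => //.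
  by rewrite mulmxA DA -scalar_mxM divrr // det_lin_unit.
by rewrite -mulmxA AD -scalar_mxM mulVr // det_lin_unit.
Qed.

Lemma invlin_det : invlin t M N *m d%:M = adjQ /\ d%:M *m invlin t M N = adjQ.
Proof.
have [DA AD] := lin_adj; rewrite /invlin; split.
  by rewrite -DA mulmxA nc_mulVmx ?mul1mx //; exact: lin_unit.
by rewrite -AD -mulmxA nc_mulmxV ?mulmx1 //; exact: lin_unit.
Qed.

End Faithful.

Section Sandwich.
Variables (n : nat) (v : A) (M N : 'M[K]_n) (u : A) (M' N' : 'M[K]_n).
Variables (C : 'M[A]_n) (i : 'cV[K]_n) (j : 'rV[K]_n).
Hypotheses (fv : faithful v) (uM : M \in unitmx).
Hypotheses (fu : faithful u) (uM' : M' \in unitmx).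

(** Each determinant turns its neighbouring inverse pencil into an adjugate over A. One stands on
    the left and the other on the right because scalars from A commute with the constant vectors [j]
    and [i], but [u] and [v] need not commute. *)
Lemma sandwich_adj : iota (ev v (\det (plin M N)))
  * ((toQ j *m invlin v M N *m iQ C *m invlin u M' N' *m toQ i) 0 0
     * iota (ev u (\det (plin M' N'))))
  = iota ((toA A j *m map_mx (ev v) (\adj (plin M N)) *m C
           *m map_mx (ev u) (\adj (plin M' N')) *m toA A i) 0 0).
Proof.
have e (a : 'M[A]_1) : iota (a 0 0) = iQ a 0 0 by rewrite mxE.
rewrite e !iQM -!toQE -entry_mul_scalar -toQ_scalarC.
have [<- _] := invlin_det fu N' uM'; have [_ <-] := invlin_det fv N uM.
rewrite mulmxA -!(mulmxA _ _ (toQ i)) !mulmxA -toQ_scalarC.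
by rewrite -!(mulmxA _%:M) entry_mul11 [_%:M 0 0]mxE eqxx.
Qed.

Lemma ratl_sandwich :
  ratl iota v ((toQ j *m invlin v M N *m iQ C *m invlin u M' N' *m toQ i) 0 0
               * iota (ev u (\det (plin M' N')))).
Proof.
by eexists; [exact: det_plin_neq0 N uM | eexists; exact: sandwich_adj].
Qed.

End Sandwich.

End QuotientMatrices.

(** * Invertibility of kappa and membership in M_x *)

Section Kappa.
Variables (K : closedFieldType) (q : K) (A : unitAlgType K).
Variables (Q : unitRingType) (iota : {rmorphism A -> Q}).
Hypotheses (q0 : q != 0) (hq : forall n, (0 < n)%N -> q ^+ n != 1).
Hypothesis hQ : quotient_skewfield iota.
Local Notation ev := horner_alg.
Local Notation toQ := (toQ iota).
Local Notation iQ := (map_mx iota).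
Local Notation invlin := (invlin iota).
Local Notation fracs := (fracs iota).

Section Pair.
Variables (u v : A).
Hypothesis uv : quantum_gen q u v.
Variables (n : nat) (z : cmquad q n).
Local Notation X := (cmX z).
Local Notation Y := (cmY z).
Local Notation i := (cmi z).
Local Notation j := (cmj z).
Let uX : X \in unitmx := cmX_unit z.
Let uY : Y \in unitmx := cmY_unit z.

Let fu : faithful u. Proof. by case: (quantum_faithful q0 hq uv). Qed.
Let fv : faithful v. Proof. by case: (quantum_faithful q0 hq uv). Qed.
Let uqY : q *: Y \in unitmx. Proof. by rewrite unitmxZ ?unitfE. Qed.

Definition cmU : 'M[A]_n := lin u X 1%:M *m lin v (q *: Y) 1%:M.
Definition cmW : 'M[A]_n := lin v Y 1%:M *m lin u X q%:M.

(** After expansion the terms linear in u and in v agree, the quadratic ones match by uv = q vu, and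
    the constant ones differ by ij according to [cm_eq]. *)
Lemma cmWE : cmW = cmU + toA A i *m toA A j.
Proof.
rewrite /cmW /cmU !linM (qg_comm uv) -toAM.
have -> : i *m j = Y *m X - q *: (X *m Y).
  by have /eqP := cm_eq z; rewrite addrC addr_eq0 opprB => /eqP.
rewrite toAB -scalemxAr !mulmx1 !mul1mx !mul_mx_scalar !toAZ !toA1.
have -> : toA A q%:M = (q%:A)%:M :> 'M[A]_n by rewrite /toA map_scalar_mx.
rewrite !scale_scalar_mx mulr1 mulr_algr.
by rewrite [RHS]addrC !addrA subrK; congr (_ + _); rewrite addrAC.
Qed.

Lemma kappaE : kappa u v iota z =
  1 + (toQ j *m invlin v (q *: Y) 1%:M *m invlin u X 1%:M *m toQ i) 0 0.
Proof.
by rewrite /kappa /invlin /lin !iQB !toQE !toA1 !scalemx1 !iQ_scalar.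
Qed.

Lemma cmU_inv : nc_unitmx (iQ cmU) /\
  nc_invmx (iQ cmU) = invlin v (q *: Y) 1%:M *m invlin u X 1%:M.
Proof. by rewrite iQM; apply: nc_invmxM; exact: lin_unit. Qed.

Lemma cmW_inv : nc_unitmx (iQ cmW) /\
  nc_invmx (iQ cmW) = invlin u X q%:M *m invlin v Y 1%:M.
Proof. by rewrite iQM; apply: nc_invmxM; exact: lin_unit. Qed.

(* Equal to kappa^{-1}; see kappa_unit. *)
Definition kappaV : Q :=
  1 - (toQ j *m nc_invmx (iQ cmW) *m toQ i) 0 0.

Lemma kappaUE : kappa u v iota z = 1 + (toQ j *m nc_invmx (iQ cmU) *m toQ i) 0 0.
Proof. by rewrite kappaE cmU_inv.2 !mulmxA. Qed.

Lemma kappaVE : kappaV =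
  1 - (toQ j *m invlin u X q%:M *m invlin v Y 1%:M *m toQ i) 0 0.
Proof. by rewrite /kappaV cmW_inv.2 !mulmxA. Qed.

Lemma kappa_unit :
  kappa u v iota z \is a GRing.unit /\ (kappa u v iota z)^-1 = kappaV.
Proof.
apply: (resolvent_unit cmU_inv.1 cmW_inv.1 _ kappaUE).
by rewrite cmWE iQD iQM !toQE.
Qed.

Lemma ratl_kappa : ratl iota v (kappa u v iota z * iota (det_shift X u)).
Proof.
rewrite kappaE mulrDl mul1r det_shiftE; apply: ratlD; first exact: ratl_iota.
have := ratl_sandwich hQ 1%:M 1%:M 1%:M i j fv uqY fu uX.
by rewrite map_mx1 mulmx1.
Qed.

Lemma ratl_kappaV : ratl iota u ((kappa u v iota z)^-1 * iota (det_shift Y v)).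
Proof.
rewrite kappa_unit.2 kappaVE mulrDl mul1r mulNr det_shiftE.
apply: ratlD; first exact: ratl_iota.
apply: ratlN; have := ratl_sandwich hQ q%:M 1%:M 1%:M i j fu uX fv uY.
by rewrite map_mx1 mulmx1.
Qed.

Local Notation M := (cm_module u v iota z).

Lemma det_in_cm_module : (iota (det_shift X u) : fracs) \in submod_pred M.
Proof. by apply/mem_span2; exists 1, 0;
  rewrite !rmorph1 !rmorph0 mulr0 mulr1 addr0. Qed.

Lemma kappaV_in_cm_module :
  ((kappa u v iota z)^-1 * iota (det_shift Y v) : fracs) \in submod_pred M.
Proof. by apply/mem_span2; exists 0, 1;
  rewrite !rmorph1 !rmorph0 mulr0 mulr1 add0r. Qed.

Lemma cm_moduleP (m : Q) : (m : fracs) \in submod_pred M <->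
  ratl iota u m /\ ratl iota v (kappa u v iota z * m).
Proof.
split=> [/mem_span2[a [b ->]]|[h1 h2]].
  split.
    by apply: ratlD; apply: ratlMr; [exact: ratl_iota | exact: ratl_kappaV].
  rewrite mulrDr !mulrA mulrV ?kappa_unit.1 // mul1r.
  by apply: ratlD; apply: ratlMr; [exact: ratl_kappa | exact: ratl_iota].
have := det_in_cm_module; have := kappaV_in_cm_module; rewrite !det_shiftE => mr mp.
exact: (mem_span2_ratl q0 hq uv hQ (det_plin_neq0 _ uX) (det_plin_neq0 _ uY)
  kappa_unit.1 mp mr h1 h2).
Qed.

End Pair.

(* kappa is unchanged when U is multiplied by constant matrices that are
   compensated in i and j. *)
Lemma kappa_const u v n (z : cmquad q n) (V : 'M[A]_n) (L R : 'M[K]_n)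
    (i : 'cV[K]_n) (j : 'rV[K]_n) : quantum_gen q u v ->
  L \in unitmx -> cmU u v z = toA A L *m V *m toA A R ->
  cmi z = L *m i -> cmj z = j *m R -> nc_unitmx (iQ V) ->
  kappa u v iota z = 1 + (toQ j *m nc_invmx (iQ V) *m toQ i) 0 0.
Proof.
move=> uv uL UE iE jE uV.
have [uLQ _] := toQ_unit iota uL.
have key : toQ R *m nc_invmx (iQ (cmU u v z)) *m toQ L = nc_invmx (iQ V).
  have h := nc_mulmxV (cmU_inv uv z).1.
  move: (nc_invmx _) h => E; rewrite UE !iQM -!toQE => h.
  have hV : iQ V *m (toQ R *m E *m toQ L) = 1%:M.
    transitivity (nc_invmx (toQ L) *m (toQ L *m iQ V *m toQ R *m E) *m toQ L).
      by rewrite !mulmxA nc_mulVmx // mul1mx.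
    by rewrite h mulmx1 nc_mulVmx.
  by rewrite -[RHS]mulmx1 -hV [RHS]mulmxA nc_mulVmx // mul1mx.
by rewrite kappaUE // iE jE !toQM -key !mulmxA.
Qed.

End Kappa.

(** * Semilinear isomorphisms of right modules *)

Section SemilinearIso.
Variable A : nzRingType.
Implicit Types (M N P : lmodType A^c) (s : A -> A).

(** For an automorphism s this encodes that N is M tensored with the inverse of A^s, without
    constructing a tensor product; see [pic_act_R_twist]. *)
Definition semilinear_iso s M N := exists F : M -> N,
  [/\ bijective F, {morph F : m m' / m + m'}
    & forall (a : A) m, F ((a : A^c) *: m) = (s a : A^c) *: F m].

Lemma semilinear_iso_id M N : semilinear_iso id M N <-> lmod_iso M N.
Proof.
split=> [[F [bF FD FZ]]|[f bf]]; last first.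
  by exists f; split=> // [m m'|a m]; [exact: raddfD | exact: linearZ].
have Flin : linear F by move=> a m m'; rewrite FD FZ.
pose mx := GRing.isLinear.Build A^c M N *:%R F Flin.
by pose f : {linear M -> N} := HB.pack F mx; exists f.
Qed.

Lemma semilinear_iso_trans s s' M N P : semilinear_iso s M N ->
  semilinear_iso s' N P -> semilinear_iso (s' \o s) M P.
Proof.
case=> F [bF FD FZ] [G [bG GD GZ]]; exists (G \o F); split; first exact: bij_comp.
  by move=> m m'; rewrite /= FD GD.
by move=> a m; rewrite /= FZ GZ.
Qed.

Lemma semilinear_iso_sym s s' M N : cancel s' s -> semilinear_iso s M N ->
  semilinear_iso s' N M.
Proof.
move=> sK [F [[G FG GF] FD FZ]]; exists G; split; first by exists F.
  by move=> m m'; apply: (can_inj FG); rewrite FD !GF.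
by move=> a m; apply: (can_inj FG); rewrite FZ sK !GF.
Qed.

Lemma eq_semilinear_iso s s' M N : s =1 s' -> semilinear_iso s M N ->
  semilinear_iso s' M N.
Proof. by move=> ss' [F [bF FD FZ]]; exists F; split=> // a m; rewrite -ss'. Qed.

Lemma semilinear_iso_lmodl s M N P : lmod_iso M N -> semilinear_iso s N P ->
  semilinear_iso s M P.
Proof. by move=> /semilinear_iso_id; exact: semilinear_iso_trans. Qed.

Lemma semilinear_iso_lmodr s M N P : semilinear_iso s M N -> lmod_iso N P ->
  semilinear_iso s M P.
Proof. by move=> h /semilinear_iso_id; exact: semilinear_iso_trans. Qed.

Lemma semilinear_iso_sub s (V V' : lmodType A^c) (U : submodule V)
    (W : submodule V') (f : V -> V') :
  {morph f : m m' / m + m'} ->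
  (forall (a : A) m, f ((a : A^c) *: m) = (s a : A^c) *: f m) ->
  injective f ->
  (forall m, m \in submod_pred U -> f m \in submod_pred W) ->
  (forall m, m \in submod_pred W -> exists2 m', m' \in submod_pred U & f m' = m) ->
  semilinear_iso s (submod_of U) (submod_of W).
Proof.
move=> fD fZ finj fU fW.
pose F (m : submod_of U) : submod_of W := exist _ (f (val m)) (fU _ (valP m)).
exists F; split; last by move=> a m; apply: val_inj; exact: fZ.
  have /choice[G GF] : forall m : submod_of W, exists m', F m' = m.
    move=> m; have [m' Um' m'E] := fW _ (valP m).
    by exists (exist _ m' Um'); exact: val_inj.
  exists G => // m; apply: val_inj; apply: finj.
  exact: (congr1 val (GF (F m))).
by move=> m m'; apply: val_inj; exact: fD.
Qed.

End SemilinearIso.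

Section AutomorphismMorph.
Variables (K : fieldType) (A : unitAlgType K).

Lemma autZ (s : automorphism A) k a : s (k *: a) = k *: s a.
Proof. exact: linearZ. Qed.

Lemma autM (s : automorphism A) a b : s (a * b) = s a * s b.
Proof. exact: rmorphM. Qed.

Lemma autD (s : automorphism A) a b : s (a + b) = s a + s b.
Proof. exact: rmorphD. Qed.

End AutomorphismMorph.

(** * Conjugation and automorphisms acting on M_x *)

Section ModuleIsos.
Variables (K : closedFieldType) (q : K) (A : unitAlgType K).
Variables (Q : unitRingType) (iota : {rmorphism A -> Q}).
Hypotheses (q0 : q != 0) (hq : forall n, (0 < n)%N -> q ^+ n != 1).
Hypothesis hQ : quotient_skewfield iota.
Local Notation ev := horner_alg.
Local Notation toQ := (toQ iota).
Local Notation iQ := (map_mx iota).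
Local Notation invlin := (invlin iota).
Local Notation fracs := (fracs iota).

Definition CMmod (u v : A) n (z : cmquad q n) : lmodType A^c :=
  submod_of (cm_module u v iota z).

Lemma lmod_iso_mull (U W : submodule fracs) (t : Q) : t \is a GRing.unit ->
  (forall m : Q, (m : fracs) \in submod_pred U ->
    (t * m : fracs) \in submod_pred W) ->
  (forall m : Q, (m : fracs) \in submod_pred W ->
    (t^-1 * m : fracs) \in submod_pred U) ->
  lmod_iso (submod_of U) (submod_of W).
Proof.
move=> ut UW WU; apply/semilinear_iso_id.
apply: (@semilinear_iso_sub _ id fracs fracs U W (fun m : Q => t * m : fracs)) => //.
- by move=> m m'; exact: mulrDr.
- by move=> a m; exact: mulrA.
- by move=> m m'; exact: mulrI.
- by move=> m /WU h; exists (t^-1 * (m : Q)) => //; exact: mulVKr.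
Qed.

Lemma CMmod_iso (u v u' v' : A) n n' (z : cmquad q n) (z' : cmquad q n') (t : Q) :
  let k := kappa u v iota z in let k' := kappa u' v' iota z' in
  t \is a GRing.unit ->
  (t * iota (det_shift (cmX z) u) : fracs)
    \in submod_pred (cm_module u' v' iota z') ->
  (t * (k^-1 * iota (det_shift (cmY z) v)) : fracs)
    \in submod_pred (cm_module u' v' iota z') ->
  (t^-1 * iota (det_shift (cmX z') u') : fracs)
    \in submod_pred (cm_module u v iota z) ->
  (t^-1 * (k'^-1 * iota (det_shift (cmY z') v')) : fracs)
    \in submod_pred (cm_module u v iota z) ->
  lmod_iso (CMmod u v z) (CMmod u' v' z').
Proof.
have aux (N : submodule fracs) (c w w' m : Q) :
    (c * w : fracs) \in submod_pred N -> (c * w' : fracs) \in submod_pred N ->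
    (m : fracs) \in submod_pred (@span2 A^c fracs w w') ->
    (c * m : fracs) \in submod_pred N.
  move=> h h' /mem_span2[a [b ->]]; rewrite mulrDr !mulrA.
  by apply: rpredD; exact: memMr.
move=> k k' ut h1 h2 h3 h4.
by apply: (lmod_iso_mull ut) => m; exact: aux.
Qed.

Lemma det_shift_conj (w u : A) n (X : 'M[K]_n) : w \is a GRing.unit ->
  det_shift X (w * u * w^-1) = w * det_shift X u * w^-1.
Proof.
move=> uw; rewrite !det_shiftE; apply: (mulIr uw); rewrite mulrVK //.
by apply: horner_alg_intertwine; rewrite mulrVK.
Qed.

Lemma kappa_conj (w u v : A) n (z : cmquad q n) : quantum_gen q u v ->
  w \is a GRing.unit ->
  kappa (w * u * w^-1) (w * v * w^-1) iota z
    = iota w * kappa u v iota z * (iota w)^-1.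
Proof.
move=> uv uw; have uiw : iota w \is a GRing.unit by exact: rmorph_unit.
have [fu fv] := quantum_faithful q0 hq uv.
have uY : q *: cmY z \in unitmx by rewrite unitmxZ ?unitfE // cmY_unit.
have invlin_conj t (M N : 'M[K]_n) : faithful t -> M \in unitmx ->
    invlin (w * t * w^-1) M N = (iota w)%:M *m invlin t M N *m (iota w^-1)%:M.
  move=> ft uM; have uL := lin_unit hQ ft N uM.
  have wK : (iota w)%:M *m (iota w^-1)%:M = 1%:M :> 'M[Q]_n.
    by rewrite -scalar_mxM -rmorphM mulrV // rmorph1.
  have Kw : (iota w^-1)%:M *m (iota w)%:M = 1%:M :> 'M[Q]_n.
    by rewrite -scalar_mxM -rmorphM mulVr // rmorph1.
  have linE : iQ (lin (w * t * w^-1) M N)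
      = (iota w)%:M *m iQ (lin t M N) *m (iota w^-1)%:M.
    rewrite -!iQ_scalar -!iQM; congr (iQ _).
    rewrite /lin mulmxBr mulmxBl !mul_scalar_mx -scalemxAl -toA_scalarC.
    rewrite mul_scalar_mx !scalerA divrr // scale1r -!scalemxAl -toA_scalarC.
    by rewrite mul_scalar_mx !scalerA.
  rewrite /invlin linE; 
  apply: (@nc_invmx_uniq _ _ _
    ((iota w)%:M *m nc_invmx (iQ (lin t M N)) *m (iota w^-1)%:M) _ _ _).2.
    rewrite !mulmxA -(mulmxA _ (iota w^-1)%:M) Kw mulmx1.
    by rewrite -(mulmxA (iota w)%:M) nc_mulmxV // mulmx1 wK.
  rewrite -!mulmxA (mulmxA (iota w^-1)%:M (iota w)%:M) Kw mul1mx.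
  by rewrite (mulmxA (nc_invmx _)) nc_mulVmx // mul1mx wK.
rewrite !kappaE !invlin_conj ?cmX_unit //.
have Kw : (iota w^-1)%:M *m (iota w)%:M = 1%:M :> 'M[Q]_n.
  by rewrite -scalar_mxM -rmorphM mulVr // rmorph1.
rewrite !mulmxA -(mulmxA _ (iota w^-1)%:M (iota w)%:M) Kw mulmx1 -toQ_scalarC.
rewrite -(mulmxA _ (iota w^-1)%:M) (toQ_scalarC _ (cmi z)) entry_mul_scalar.
rewrite -!(mulmxA (iota w)%:M) entry_mul11 [_%:M 0 0]mxE eqxx.
by rewrite rmorphV // mulrDr mulrDl mulr1 divrr.
Qed.

Lemma quantum_gen_conj (w u v : A) : w \is a GRing.unit ->
  quantum_gen q u v -> quantum_gen q (w * u * w^-1) (w * v * w^-1).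
Proof.
move=> uw [uu uv cuv ind].
have cM a b : (w * a * w^-1) * (w * b * w^-1) = w * (a * b) * w^-1.
  by rewrite !mulrA mulrVK.
have cV a : a \is a GRing.unit -> (w * a * w^-1)^-1 = w * a^-1 * w^-1.
  by move=> ua; rewrite !invrM ?invrK ?unitrMl ?unitrV // ?mulrA.
split; rewrite ?unitrMl ?unitrV //.
  by rewrite !cM cuv -scalerAr -scalerAl.
move=> S S1 SL SM; rewrite !cV // => Su SuV Sv SvV a.
have -> : a = w * (w^-1 * a * w) * w^-1 by rewrite !mulrA mulrV // mul1r mulrK.
move: (w^-1 * a * w); apply: (ind (fun b => S (w * b * w^-1))) => //.
- by rewrite mulr1 mulrV.
- by move=> k b c Sb Sc; rewrite mulrDr mulrDl -scalerAr -scalerAl; exact: SL.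
- by move=> b c Sb Sc; rewrite -cM; exact: SM.
Qed.

(** Left multiplication by [iota w] carries det(X - u) to det(X - w u w^-1) w, and similarly for the
    other generator; the trailing unit w is absorbed by the right action of A. *)
Lemma CMmod_conj (w u v : A) n (z : cmquad q n) : quantum_gen q u v ->
  w \is a GRing.unit ->
  lmod_iso (CMmod u v z) (CMmod (w * u * w^-1) (w * v * w^-1) z).
Proof.
move=> uv uw; have uiw : iota w \is a GRing.unit by exact: rmorph_unit.
have uk := (kappa_unit q0 hq hQ uv z).1.
apply: (@CMmod_iso _ _ _ _ _ _ _ _ (iota w)) => //.
- apply: (@memMrK _ _ _ _ _ _ w^-1); first by rewrite unitrV.
  by rewrite -!rmorphM -det_shift_conj //; exact: det_in_cm_module.
- apply: (@memMrK _ _ _ _ _ _ w^-1); first by rewrite unitrV.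
  have := kappaV_in_cm_module iota (w * u * w^-1) (w * v * w^-1) z.
  rewrite kappa_conj // det_shift_conj // !rmorphM !invrM ?invrK ?unitrMl ?unitrV //.
  by rewrite !mulrA mulrVK.
- apply: (@memMrK _ _ _ _ _ _ w) => //.
  rewrite det_shift_conj // !rmorphM -!mulrA -rmorphM mulVr // rmorph1 mulr1.
  by rewrite mulKr //; exact: det_in_cm_module.
- apply: (@memMrK _ _ _ _ _ _ w) => //.
  have := kappaV_in_cm_module iota u v z.
  rewrite kappa_conj // det_shift_conj // !rmorphM !invrM ?invrK ?unitrMl ?unitrV //.
  rewrite -!mulrA -rmorphM mulVr // rmorph1 mulr1 !mulKr //.
Qed.

Section Ideal.
Variables (u v : A) (n : nat) (z : cmquad q n).

(* det(X - qx1) clears the denominators of M_x on the left; the resulting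
   ideal of A is visibly natural in (u, v). *)
Definition cm_denom : A := ev u (\det (plin (cmX z) q%:M)).

(** This is [cm_denom] times kappa^-1 det(Y - v), written with adjugates so as to lie in A; see
    [cm_numerE]. *)
Definition cm_numer : A :=
  cm_denom * det_shift (cmY z) v
  - (toA A (cmj z) *m map_mx (ev u) (\adj (plin (cmX z) q%:M))
     *m map_mx (ev v) (\adj (plin (cmY z) 1%:M)) *m toA A (cmi z)) 0 0.

Definition cm_ideal : submodule (A^c)^o :=
  @span2 A^c (A^c)^o (cm_denom * det_shift (cmX z) u) cm_numer.

Hypothesis uv : quantum_gen q u v.

Let fu : faithful u. Proof. by case: (quantum_faithful q0 hq uv). Qed.
Let fv : faithful v. Proof. by case: (quantum_faithful q0 hq uv). Qed.
Let uX := cmX_unit z.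
Let uY := cmY_unit z.

Lemma cm_denom_unit : iota cm_denom \is a GRing.unit.
Proof. exact: det_lin_unit. Qed.

Lemma cm_numerE : iota cm_numer =
  iota cm_denom * ((kappa u v iota z)^-1 * iota (det_shift (cmY z) v)).
Proof.
rewrite (kappa_unit q0 hq hQ uv z).2 kappaVE // mulrBl mul1r mulrBr /cm_numer.
rewrite rmorphB rmorphM; congr (_ - _); rewrite det_shiftE.
have := sandwich_adj hQ q%:M 1%:M 1%:M (cmi z) (cmj z) fu uX fv uY.
by rewrite map_mx1 !mulmx1 => <-.
Qed.

Lemma CMmod_ideal : lmod_iso (CMmod u v z) (submod_of cm_ideal).
Proof.
have ud := cm_denom_unit.
apply: lmod_iso_sym; apply/semilinear_iso_id.
pose f (a : (A^c)^o) : fracs := (iota cm_denom)^-1 * iota (a : A).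
apply: (@semilinear_iso_sub _ id (A^c)^o fracs cm_ideal (cm_module u v iota z) f).
- by move=> a b; rewrite /f rmorphD mulrDr.
- move=> a b; rewrite /f [in LHS]regular_rscaleE rmorphM mulrA; exact: erefl.
- move=> a b /(mulrI _) h; apply: (qsf_inj hQ); apply: h; by rewrite unitrV.
- move=> a /asboolP[b [c aE]].
  have -> : f a = (iota (det_shift (cmX z) u) * iota b
      + (kappa u v iota z)^-1 * iota (det_shift (cmY z) v) * iota c : Q).
    rewrite /f aE rmorphD !regular_rscaleE !rmorphM cm_numerE mulrDr.
    by rewrite !mulrA mulVr // !mul1r.
  by apply/mem_span2; exists b, c.
- move=> m /mem_span2[b [c ->]].
  exists (cm_denom * det_shift (cmX z) u * b + cm_numer * c : A).
    by apply/asboolP; exists b, c.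
  rewrite /f rmorphD !rmorphM cm_numerE mulrDr.
  by rewrite !mulrA mulVr // !mul1r.
Qed.

Lemma cm_ideal_nz : exists2 a, a \in submod_pred cm_ideal & a != 0.
Proof.
exists (cm_denom * det_shift (cmX z) u).
  by apply/asboolP; exists 1, 0; rewrite scale1r scale0r addr0.
apply/eqP => /(congr1 iota); rewrite rmorph0 rmorphM det_shiftE => h.
have p0 : iota (ev u (\det (plin (cmX z) 1%:M))) = 0.
  by apply: (mulrI cm_denom_unit); rewrite h mulr0.
by have := det_lin_unit hQ fu 1%:M uX; rewrite p0 unitr0.
Qed.

End Ideal.

Lemma horner_alg_morph (s : {lrmorphism A -> A}) u f : s (ev u f) = ev (s u) f.
Proof.
elim/poly_ind: f => [|f c IH]; first by rewrite !rmorph0.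
rewrite !rmorphD !rmorphM /= IH !horner_algX !horner_algC linearZ /= rmorph1.
by [].
Qed.

Lemma det_shift_morph (s : {lrmorphism A -> A}) n (M : 'M[K]_n) u :
  s (det_shift M u) = det_shift M (s u).
Proof. by rewrite !det_shiftE horner_alg_morph. Qed.

Lemma cm_ideal_morph (s : {lrmorphism A -> A}) u v n (z : cmquad q n) :
  s (cm_denom u z) = cm_denom (s u) z /\
  s (cm_numer u v z) = cm_numer (s u) (s v) z.
Proof.
have sA m p (M : 'M[K]_(m, p)) : map_mx s (toA A M) = toA A M.
  by apply/matrixP=> a b; rewrite !mxE linearZ /= rmorph1.
have sev m p t (M : 'M[{poly K}]_(m, p)) : map_mx s (map_mx (ev t) M) = map_mx (ev (s t)) M.
  by apply/matrixP=> a b; rewrite !mxE horner_alg_morph.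
have smx (i : 'cV[K]_n) (j : 'rV[K]_n) (B C : 'M[{poly K}]_n) :
    s ((toA A j *m map_mx (ev u) B *m map_mx (ev v) C *m toA A i) 0 0)
    = (toA A j *m map_mx (ev (s u)) B *m map_mx (ev (s v)) C *m toA A i) 0 0.
  have -> (a : 'M[A]_1) : s (a 0 0) = map_mx s a 0 0 by rewrite mxE.
  by rewrite !map_mxM !sA !sev.
have sden : s (cm_denom u z) = cm_denom (s u) z by exact: horner_alg_morph.
have sB a b : s (a - b) = s a - s b by exact: rmorphB.
have sM a b : s (a * b) = s a * s b by exact: rmorphM.
split=> //; rewrite /cm_numer sB sM smx sden.
by rewrite det_shift_morph.
Qed.

Lemma quantum_gen_aut (s : automorphism A) u v : quantum_gen q u v ->
  quantum_gen q (s u) (s v).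
Proof.
case=> uu uv cuv ind; split; rewrite ?rmorph_unit //.
  by rewrite -!autM cuv autZ.
move=> S S1 SL SM Su SuV Sv SvV a.
rewrite -(aut_invK s a); move: (aut_inv s a); apply: ind;
  rewrite ?rmorph1 ?rmorphV //.
  by move=> k b c; rewrite autD autZ; exact: SL.
by move=> b c; rewrite autM; exact: SM.
Qed.

(** Both modules are replaced by their ideals in A, where s is defined. As s fixes constants, it
    carries the generators at (u, v) to those at (s u, s v). *)
Lemma CMmod_aut (s : automorphism A) u v n (z : cmquad q n) : quantum_gen q u v ->
  semilinear_iso s (CMmod u v z) (CMmod (s u) (s v) z).
Proof.
move=> uv; apply: (semilinear_iso_lmodl (CMmod_ideal z uv)).
apply: (semilinear_iso_lmodr _ (lmod_iso_sym (CMmod_ideal z (quantum_gen_aut s uv)))).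
have [sd sn] := cm_ideal_morph s u v z.
apply: (@semilinear_iso_sub _ s (A^c)^o (A^c)^o _ _ s).
- exact: autD.
- by move=> a b; rewrite !regular_rscaleE autM.
- exact: can_inj (aut_funK s).
- move=> a /asboolP[b [c ->]]; apply/asboolP; exists (s b), (s c).
  by rewrite autD !regular_rscaleE !autM sd sn det_shift_morph.
- move=> a /asboolP[b [c ->]].
  exists (cm_denom u z * det_shift (cmX z) u * aut_inv s b + cm_numer u v z * aut_inv s c).
    by apply/asboolP; exists (aut_inv s b), (aut_inv s c).
  by rewrite autD !autM sd sn !aut_invK det_shift_morph.
Qed.

End ModuleIsos.

(** * Gauge changes, scalings, g_1 and g_2 *)

Section GeneratorActions.
Variables (K : closedFieldType) (q : K) (A : unitAlgType K).
Variables (Q : unitRingType) (iota : {rmorphism A -> Q}).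
Hypotheses (q0 : q != 0) (hq : forall n, (0 < n)%N -> q ^+ n != 1).
Hypothesis hQ : quotient_skewfield iota.
Local Notation toQ := (toQ iota).
Local Notation iQ := (map_mx iota).
Local Notation invlin := (invlin iota).
Local Notation CMmod := (CMmod iota).

(** By [cm_moduleP] the module depends only on kappa and on which elements of Q have denominators in
    u and in v. *)
Lemma CMmod_eq (u v u' v' : A) n n' (z : cmquad q n) (z' : cmquad q n') :
  quantum_gen q u v -> quantum_gen q u' v' ->
  kappa u v iota z = kappa u' v' iota z' ->
  (forall m, ratl iota u m <-> ratl iota u' m) ->
  (forall m, ratl iota v m <-> ratl iota v' m) ->
  lmod_iso (CMmod u v z) (CMmod u' v' z').
Proof.
move=> uv uv' kE hu hv; apply: (@lmod_iso_mull _ _ _ _ _ _ 1); first exact: unitr1.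
  move=> m /(cm_moduleP q0 hq hQ uv z)[h1 h2]; rewrite mul1r.
  apply/(cm_moduleP q0 hq hQ uv' z'); rewrite -kE.
  by split; [exact/hu | exact/hv].
move=> m /(cm_moduleP q0 hq hQ uv' z')[h1 h2]; rewrite invr1 mul1r.
apply/(cm_moduleP q0 hq hQ uv z); rewrite kE.
by split; [exact/hu | exact/hv].
Qed.

Lemma CMmod_gauge (u v : A) n (z z' : cmquad q n) : quantum_gen q u v ->
  gauge_eq z z' -> lmod_iso (CMmod u v z) (CMmod u v z').
Proof.
move=> uv [g ug [XE YE iE jE]]; apply: CMmod_eq => //.
have [uU _] := cmU_inv q0 hq hQ uv z.
have UE : cmU u v z' = toA A g *m cmU u v z *m toA A (invmx g).
  rewrite /cmU mulmxA toA_lin -!mulmxA lin_toA XE YE.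
  have -> : lin u (g *m cmX z *m invmx g) 1%:M
      = lin u (g *m cmX z) (g *m 1%:M) *m toA A (invmx g).
    by rewrite lin_toA mulmx1 mulmxV.
  rewrite -mulmxA toA_lin; congr (_ *m lin v _ _); last by rewrite mul1mx mulmx1.
  by rewrite -!scalemxAl -scalemxAr !mulmxA mulVmx // mul1mx.
by rewrite (kappa_const q0 hq hQ uv ug UE iE jE uU) -(kappaUE q0 hq hQ uv).
Qed.

Lemma quantum_gen_scale (u v : A) a b : a != 0 -> b != 0 ->
  quantum_gen q u v -> quantum_gen q (a *: u) (b *: v).
Proof.
move=> a0 b0 [uu uv cuv ind]; split; rewrite ?scaler_unit ?unitfE //.
  by rewrite -!scalerAl -!scalerAr cuv !scalerA; congr (_ *: _);
    rewrite mulrC mulrA mulrAC.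
move=> S S1 SL SM; rewrite !invrZ ?unitfE // => Su SuV Sv SvV.
have S0 : S 0 by rewrite -(subrr 1) addrC -scaleN1r; exact: SL.
have SZ k c : S c -> S (k *: c) by move=> Sc; rewrite -[_ *: _]addr0; exact: SL.
apply: ind => //.
- by rewrite -[u](scalerK a0); exact: SZ.
- by rewrite -[u^-1](scalerKV a0) ; exact: SZ.
- by rewrite -[v](scalerK b0); exact: SZ.
- by rewrite -[v^-1](scalerKV b0); exact: SZ.
Qed.

Lemma linZ n c t (M N : 'M[K]_n) : lin (c *: t : A) M N = lin t M (c *: N).
Proof. by rewrite /lin toAZ scalerA mulr_algr. Qed.

(** The two matrices U differ by a constant factor, which is exactly the one that [cm_scale] puts on
    [cmi]; hence kappa is the same. *)
Lemma CMmod_scale (x y : A) (a b : K) (ha : a != 0) (hb : b != 0) n (z : cmquad q n) :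
  quantum_gen q x y ->
  lmod_iso (CMmod (a *: x) (b *: y) z)
           (CMmod x y (cm_scale (invr_neq0 ha) (invr_neq0 hb) z)).
Proof.
move=> xy; have xy' := quantum_gen_scale ha hb xy.
apply: CMmod_eq => //; [symmetry | by move=> m; exact: ratlZ..].
have [uU _] := cmU_inv q0 hq hQ xy' z.
have uL : ((a^-1 / b)%:M : 'M[K]_n) \in unitmx.
  by rewrite -scalemx1 unitmxZ ?unitmx1 // unitfE mulf_neq0 ?invr_eq0.
set z' := cm_scale _ _ z.
have UE : cmU x y z' = toA A (a^-1 / b)%:M *m cmU (a *: x) (b *: y) z *m toA A 1%:M.
  have linV c t (M : 'M[K]_n) : c != 0 ->
      lin t (c^-1 *: M) 1%:M = toA A c^-1%:M *m lin t M c%:M.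
    by move=> c0; rewrite toA_lin mul_scalar_mx -scalar_mxM mulVf.
  have linC c t (M N : 'M[K]_n) : lin t M N *m toA A c%:M = toA A c%:M *m lin t M N.
    by rewrite toA_lin lin_toA !scalar_mxC.
  rewrite toA1 mulmx1 /cmU !linZ !scalemx1 scalar_mxM toAM /=.
  rewrite linV // scalerA mulrC -scalerA linV //.
  by rewrite -!mulmxA; congr (_ *m _); rewrite !mulmxA linC.
have iE : cmi z' = (a^-1 / b)%:M *m cmi z by rewrite mul_scalar_mx.
have jE : cmj z' = cmj z *m 1%:M by rewrite mulmx1.
by rewrite (kappa_const q0 hq hQ xy uL UE iE jE uU) (kappaUE q0 hq hQ xy').
Qed.

(** When a difference of two U factors as L1 C L2, its outer factors cancel two of the four inverse
    pencils, leaving the shape handled by [ratl_sandwich]. *)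
Lemma nc_sandwich n (L1 L2 C : 'M[A]_n) (F1 F2 : 'M[Q]_n) (i : 'cV_n) (j : 'rV_n) :
  nc_unitmx (iQ L1) -> nc_unitmx (iQ L2) ->
  j *m (F1 *m nc_invmx (iQ L1)) *m iQ (L1 *m C *m L2) *m (nc_invmx (iQ L2) *m F2) *m i
  = j *m F1 *m iQ C *m F2 *m i.
Proof.
move=> u1 u2; rewrite !iQM !mulmxA -(mulmxA _ (nc_invmx (iQ L1))) nc_mulVmx //.
by rewrite mulmx1 -(mulmxA _ (iQ L2)) nc_mulmxV // mulmx1.
Qed.

Lemma CMmod_g1 (x y : A) n (z : cmquad q n) : quantum_gen q x y ->
  quantum_gen q (y * x) y -> lmod_iso (CMmod (y * x) y z) (CMmod x y (cm_g1 z)).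
Proof.
move=> xy wy; set w := y * x in wy *; set z' := cm_g1 z.
have [fx fy] := quantum_faithful q0 hq xy; have [fw _] := quantum_faithful q0 hq wy.
have uX := cmX_unit z; have uY := cmY_unit z.
set X := cmX z in uX *; set Y := cmY z in uY *.
have uqY : q *: Y \in unitmx by rewrite unitmxZ ?unitfE.
(* [V] is [cmU x y z'] with [invmx Y] cleared on the left, which also turns the vector of z' into
   [cmi z]. Both kappas then involve the same i and j, as [resolvent] requires. *)
pose V : 'M[A]_n := lin x X Y *m lin y (q *: Y) 1%:M.
have [uV VI] : nc_unitmx (iQ V) /\
    nc_invmx (iQ V) = invlin y (q *: Y) 1%:M *m invlin x X Y.
  by rewrite iQM; apply: nc_invmxM; exact: lin_unit.
have UE : cmU x y z' = toA A (invmx Y) *m V *m toA A 1%:M.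
  by rewrite toA1 mulmx1 /V mulmxA toA_lin mulVmx.
have k'E : kappa x y iota z' = 1 + (toQ (cmj z) *m nc_invmx (iQ V) *m toQ (cmi z)) 0 0.
  apply: (kappa_const q0 hq hQ xy _ UE) => //; first by rewrite unitmx_inv.
  by rewrite mulmx1.
have WE : V + toA A (cmi z) *m toA A (cmj z) = lin y Y 1%:M *m lin x X (q *: Y).
  have := congr1 (mulmx (toA A Y)) (cmWE xy z').
  rewrite mulmxDr UE toA1 mulmx1 !mulmxA -!toAM !mulmxA mulmxV // mul1mx toA1 mul1mx => <-.
  rewrite toA_lin mulmx1; have -> : lin y (Y *m cmY z') Y = lin y Y 1%:M *m toA A Y.
    by rewrite lin_toA mul1mx.
  by rewrite -mulmxA toA_lin mulmxA mulmxV // mul1mx mul_mx_scalar.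
have VWE : iQ V + toQ (cmi z) *m toQ (cmj z)
    = iQ (lin y Y 1%:M *m lin x X (q *: Y)).
  by rewrite !toQE -iQM -iQD WE.
have [uW WI] : nc_unitmx (iQ (lin y Y 1%:M *m lin x X (q *: Y))) /\
    nc_invmx (iQ (lin y Y 1%:M *m lin x X (q *: Y)))
      = invlin x X (q *: Y) *m invlin y Y 1%:M.
  by rewrite iQM; apply: nc_invmxM; exact: lin_unit.
have [uU UI] := cmU_inv q0 hq hQ wy z; have [uWs WsI] := cmW_inv q0 hq hQ wy z.
have WsE : iQ (cmU w y z) + toQ (cmi z) *m toQ (cmj z) = iQ (cmW w y z).
  by rewrite (cmWE wy) iQD iQM !toQE.
(* X - w and X - xY differ by xY - yx = (Y - y) x, and Y - y is a factor of W. *)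
have D : cmU w y z - V = lin y Y 1%:M *m x%:M *m lin y (q *: Y) 1%:M.
  rewrite /V /cmU -mulmxBl; congr (_ *m _).
  rewrite /lin mulmxBl -toA_scalarC mul_scalar_mx !toA1 -scalemxAl mul1mx.
  by rewrite !scale_scalar_mx mulr1 -/w opprB addrC addrA subrK.
have D' : V - cmU w y z = lin y Y 1%:M *m (- x%:M) *m lin y (q *: Y) 1%:M.
  by rewrite -opprB D mulmxN mulNmx.
have uyY := lin_unit hQ fy 1%:M uY; have uyqY := lin_unit hQ fy 1%:M uqY.
have DQ := congr1 (map_mx iota) D'; rewrite iQB in DQ.
have DQ' := congr1 (map_mx iota) D; rewrite iQB in DQ'.
have ksE := kappaUE q0 hq hQ wy z.
have [uk' h1 _] := resolvent_inv uU uV uW VWE DQ UI WI ksE k'E.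
have [uks h2 _] := resolvent_inv uV uU uWs WsE DQ' VI WsI k'E ksE.
rewrite nc_sandwich // in h1; rewrite nc_sandwich // in h2.
set k' := kappa x y iota z' in uk' h1 h2; set ks := kappa w y iota z in uks h1 h2.
have ut : k'^-1 * ks \is a GRing.unit by rewrite unitrMl ?unitrV.
have tV : (k'^-1 * ks)^-1 = ks^-1 * k' by rewrite invrM ?unitrV // invrK.
(* This multiplier matches the second generators exactly, since det(Y - y) is common to both
   modules. Only the first ones need [cm_moduleP]. *)
apply: (@CMmod_iso _ _ _ _ _ _ _ _ _ _ _ _ _ (k'^-1 * ks)) => //;
  rewrite ?tV -/k' -/ks.
- apply/(cm_moduleP q0 hq hQ xy z'); rewrite -/k' mulrA mulVKr //; split;
  last first.
    exact: (ratl_kappa q0 hq hQ wy z).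
  rewrite h1 mulrDl mul1r det_shiftE; apply: ratlD; first exact: ratl_iota.
  exact: ratl_sandwich.
- rewrite -mulrA mulVKr //; exact: (kappaV_in_cm_module iota x y z').
- apply/(cm_moduleP q0 hq hQ wy z); rewrite -/ks mulrA mulVKr //; split; last first.
    exact: (ratl_kappa q0 hq hQ xy z').
  rewrite h2 mulrDl mul1r; apply: ratlD; first exact: ratl_iota.
  have -> : det_shift (cmX z') x
      = horner_alg x (\det (plin X Y)) * ((\det Y)^-1)%:A.
    rewrite det_shiftE mulr_algr -horner_algZ; congr horner_alg.
    have -> : \det (plin X Y) = (\det Y)%:P * \det (plin (cmX z') 1%:M).
      by rewrite -det_plin_mull mulmx1 mulmxA mulmxV // mul1mx.
    by rewrite mul_polyC scalerA mulVf ?scale1r // -unitfE -unitmxE.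
  by rewrite rmorphM mulrA; apply: ratlMr; exact: ratl_sandwich.
- rewrite -mulrA mulVKr //; exact: (kappaV_in_cm_module iota w y z).
Qed.

Lemma CMmod_g2 (x y : A) n (z : cmquad q n) : quantum_gen q x y ->
  quantum_gen q x (y / x) -> lmod_iso (CMmod x (y / x) z) (CMmod x y (cm_g2 z)).
Proof.
move=> xy xyx; have ux := qg_unit_x xy.
(* Conjugation by x^-1 replaces y / x by this v, for which y = q v x. The difference below then
   contains X - qx, the factor coming from W; with y / x it would contain X - x. *)
pose v := x^-1 * y.
have uxV : x^-1 \is a GRing.unit by rewrite unitrV.
have e1 : x^-1 * x * x^-1^-1 = x by rewrite invrK mulVr // mul1r.
have e2 : x^-1 * (y / x) * x^-1^-1 = v by rewrite invrK -mulrA mulrVK.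
have := CMmod_conj q0 hq hQ z xyx uxV; have := quantum_gen_conj uxV xyx.
rewrite e1 e2 => xv h; apply: lmod_iso_trans h _; set z' := cm_g2 z.
have [fx fy] := quantum_faithful q0 hq xy; have [_ fv] := quantum_faithful q0 hq xv.
have uX := cmX_unit z; have uY := cmY_unit z.
set X := cmX z in uX *; set Y := cmY z in uY *.
have uqY : q *: Y \in unitmx by rewrite unitmxZ ?unitfE.
(* Here X is cleared on the right of [cmU x y z'], which turns [cmj z'] into [cmj z]. *)
pose V : 'M[A]_n := lin x X 1%:M *m lin y (q *: Y) (invmx X).
have [uV VI] : nc_unitmx (iQ V) /\
    nc_invmx (iQ V) = invlin y (q *: Y) (invmx X) *m invlin x X 1%:M.
  by rewrite iQM; apply: nc_invmxM; exact: lin_unit.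
have UE : cmU x y z' = toA A 1%:M *m V *m toA A X.
  by rewrite toA1 mul1mx /V -mulmxA lin_toA mulVmx // -scalemxAl.
have k'E : kappa x y iota z' = 1 + (toQ (cmj z) *m nc_invmx (iQ V) *m toQ (cmi z)) 0 0.
  by apply: (kappa_const q0 hq hQ xy _ UE) => //; rewrite ?unitmx1 ?mul1mx.
have WE : V + toA A (cmi z) *m toA A (cmj z) = lin y Y (invmx X) *m lin x X q%:M.
  have := congr1 (mulmx^~ (toA A (invmx X))) (cmWE xy z').
  rewrite mulmxDl UE toA1 mul1mx -!mulmxA -!toAM -!mulmxA mulmxV // mulmx1 toA1 mulmx1 => <-.
  rewrite lin_toA mulmxV //.
  have -> : lin x 1%:M (q%:M *m invmx X) = toA A (invmx X) *m lin x X q%:M.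
    by rewrite toA_lin mulVmx // scalar_mxC.
  by rewrite mulmxA lin_toA mul1mx -mulmxA mulmxV // mulmx1.
have VWE : iQ V + toQ (cmi z) *m toQ (cmj z)
    = iQ (lin y Y (invmx X) *m lin x X q%:M).
  by rewrite !toQE -iQM -iQD WE.
have [uW WI] : nc_unitmx (iQ (lin y Y (invmx X) *m lin x X q%:M)) /\
    nc_invmx (iQ (lin y Y (invmx X) *m lin x X q%:M))
      = invlin x X q%:M *m invlin y Y (invmx X).
  by rewrite iQM; apply: nc_invmxM; exact: lin_unit.
have [uU UI] := cmU_inv q0 hq hQ xv z; have [uWv WvI] := cmW_inv q0 hq hQ xv z.
have WvE : iQ (cmU x v z) + toQ (cmi z) *m toQ (cmj z) = iQ (cmW x v z).
  by rewrite (cmWE xv) iQD iQM !toQE.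
pose C : 'M[A]_n := v *: toA A (invmx X).
have D : V - cmU x v z = lin x X 1%:M *m C *m lin x X q%:M.
  have vxq : v * x * q%:A = y.
    by rewrite mulr_algr /v -mulrA scalerAr -(qg_comm xy) mulKr.
  rewrite /V /cmU -mulmxBr -mulmxA; congr (_ *m _).
  rewrite /C -scalemxAl /lin mulmxBr toA_scale -!toAM mulVmx // toA1 mul_mx_scalar.
  by rewrite !toAZ scalerBr !scalerA vxq opprB addrC addrA subrK.
have D' : cmU x v z - V = lin x X 1%:M *m (- C) *m lin x X q%:M.
  by rewrite -opprB D mulmxN mulNmx.
have uxX := lin_unit hQ fx 1%:M uX; have uxqX := lin_unit hQ fx q%:M uX.
have DQ := congr1 (map_mx iota) D; rewrite iQB in DQ.
have DQ' := congr1 (map_mx iota) D'; rewrite iQB in DQ'.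
have kvE := kappaUE q0 hq hQ xv z.
have [uk' _ h1] := resolvent_inv uU uV uW VWE DQ UI WI kvE k'E.
have [ukv _ h2] := resolvent_inv uV uU uWv WvE DQ' VI WvI k'E kvE.
rewrite nc_sandwich // in h1; rewrite nc_sandwich // in h2.
set k' := kappa x y iota z' in uk' h1 h2; set kv := kappa x v iota z in ukv h1 h2.
apply: (@CMmod_iso _ _ _ _ _ _ _ _ _ _ _ _ _ 1);
  rewrite ?unitr1 // ?invr1 !mul1r -/k' -/kv.
- exact: (det_in_cm_module iota x y z').
- apply/(cm_moduleP q0 hq hQ xy z'); rewrite -/k' mulrA; split.
    exact: (ratl_kappaV q0 hq hQ xv z).
  rewrite h2 mulrDl mul1r det_shiftE; apply: ratlD; first exact: ratl_iota.
  exact: ratl_sandwich.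
- exact: (det_in_cm_module iota x v z).
- apply/(cm_moduleP q0 hq hQ xv z); rewrite -/kv mulrA; split.
    exact: (ratl_kappaV q0 hq hQ xy z').
  rewrite h1 mulrDl mul1r; apply: ratlD; first exact: ratl_iota.
  have -> : det_shift (cmY z') y
      = horner_alg y (\det (plin Y (invmx X))) * (\det X)%:A.
    rewrite det_shiftE mulr_algr -horner_algZ; congr horner_alg.
    by rewrite -mul_polyC mulrC -det_plin_mulr mulVmx.
  by rewrite rmorphM mulrA; apply: ratlMr; exact: ratl_sandwich.
Qed.

End GeneratorActions.

(** * Tensor products with twisted bimodules *)

Section SemilinearTensor.
Local Open Scope quotient_scope.
Variables (K : fieldType) (A : unitAlgType K).

(** Through [f], P is A with left action twisted by t. As t is onto, p is the left multiple of
    [p1 = f' 1] by t'(f p), so a balanced map is determined by its values at [p1]. *)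
Lemma is_tensor_semilinear (t t' : A -> A) (M N : lmodType A^c) (P : bimodule A)
    (F : M -> N) (f : P -> A) : cancel t' t ->
  bijective F -> {morph F : m m' / m + m'} ->
  (forall (a : A) m, F ((a : A^c) *: m) = (t a : A^c) *: F m) ->
  bijective f -> {morph f : p p' / p + p'} ->
  (forall (a : A) p, f ((a : A^c) *: p) = f p * a) ->
  (forall a p, f (lact a p) = t a * f p) ->
  @is_tensor K A M P N (fun m p => (f p : A^c) *: F m).
Proof.
move=> tK [F' FK F'K] FD FZ [f' fK f'K] fD fZ fL.
have lM (a b : A) (n : N) : (b : A^c) *: ((a : A^c) *: n) = (a * b : A^c) *: n.
  exact: scalerA.
split.
- split=> [m m' p|m p p'|m a p]; first by rewrite FD scalerDr.
    by rewrite fD; exact: scalerDl.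
  by rewrite FZ lM fL.
- by move=> m p a; rewrite (fZ a) -lM.
move=> W b [bDl bDr bZ]; pose p1 := f' 1; pose g n := b (F' n) p1.
have F'D : {morph F' : n n' / n + n'}.
  by move=> n n'; apply: (can_inj FK); rewrite FD !F'K.
have gD : nmod_morphism g.
  split; last by move=> n n'; rewrite /g F'D bDl.
  by apply: (addrI (g 0)); rewrite -{1}bDl -F'D !addr0.
pose mx := GRing.isNmodMorphism.Build N W g gD.
pose ga : {additive N -> W} := HB.pack g mx.
have gtau m p : g ((f p : A^c) *: F m) = b m p.
  rewrite /g; have -> : F' ((f p : A^c) *: F m) = (t' (f p) : A^c) *: m.
    by apply: (can_inj FK); rewrite F'K FZ tK.
  rewrite bZ; congr b; apply: (can_inj fK).
  by rewrite fL tK f'K mulr1.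
exists ga; split=> // h hE n.
by rewrite -[n in LHS]scale1r -[n in LHS]F'K -[1 in LHS]f'K hE.
Qed.

Definition inv_aut (s : automorphism A) : automorphism A :=
  Automorphism (aut_invK s) (aut_funK s).

Lemma inverse_bimod_twist (s : automorphism A) (P : bimodule A) :
  bimod_iso P (twist s) -> inverse_bimod P (twist (inv_aut s)).
Proof.
case=> f [bf fL].
have fD p p' : (f (p + p') : A) = (f p : A) + (f p' : A) by exact: raddfD.
have fZ (a : A) p : (f ((a : A^c) *: p) : A) = (f p : A) * a.
  exact: (linearZ_LR f (a : A^c) p).
split.
  exists (fun p (p' : (A^c)^o) => (p' : A^c) *: (s (f p) : (A^c)^o)); split.
    apply: (@is_tensor_semilinear s (aut_inv s) P (A^c)^o (twist (inv_aut s))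
      (fun p => s (f p) : (A^c)^o) (fun p => p)) => //.
    - exact: aut_invK.
    - by apply: bij_comp bf; exists (aut_inv s);
      [exact: aut_funK | exact: aut_invK].
    - by move=> p p'; rewrite fD; exact: (autD s (f p) (f p')).
    - by move=> a p; rewrite fZ; exact: (autM s (f p) a).
    - by exists id.
  move=> a p p'; rewrite fL /= !regular_rscaleE autM aut_invK mulrA.
  by [].
exists (fun (p' : (A^c)^o) p => ((f p : A) : A^c) *: (aut_inv s p' : (A^c)^o));
  split.
  apply: (@is_tensor_semilinear (aut_inv s) s (A^c)^o (A^c)^o P
     (fun p : (A^c)^o => aut_inv s p : (A^c)^o) (fun p => f p : A)) => //.
  - exact: aut_funK.
  - by exists s; [exact: aut_invK | exact: aut_funK].
  - by move=> p p'; exact: (autD (inv_aut s) p p').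
  - by move=> a p; exact: (autM (inv_aut s) p a).
by move=> a p' p; rewrite /= !regular_rscaleE rmorphM /= aut_funK mulrA.
Qed.

Lemma pic_act_R_twist (s : automorphism A) (P : bimodule A) (r r' : Rcal A) :
  bimod_iso P (twist s) ->
  semilinear_iso s (ideal_mod (repr r)) (ideal_mod (repr r')) -> pic_act_R P r r'.
Proof.
move=> Ps [F [bF FD FZ]]; exists (twist (inv_aut s)); split.
  exact: inverse_bimod_twist.
exists (fun m (p : (A^c)^o) => (p : A^c) *: F m).
apply: (@is_tensor_semilinear s (aut_inv s) _ _ (twist (inv_aut s)) F
  (fun p => p)) => //.
  exact: aut_invK.
by exists id.
Qed.

(** The class of I lies in the set searched by [xget], so the default value is not taken. *)
Lemma class_of_moduleP (M : lmodType A^c) (I : nzideal A) :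
  lmod_iso M (ideal_mod I) -> lmod_iso M (ideal_mod (repr (class_of_module M))).
Proof.
move=> MI; rewrite /class_of_module; case: xgetP => [r _ //|].
move=> /(_ (\pi_(Rcal A) I))[] /=; case: piP => J /eqmodP /asboolP.
exact: lmod_iso_trans.
Qed.

End SemilinearTensor.

(** * Generation of the semidirect product *)

Section TorusSL2.
Variable K : fieldType.
Implicit Types (g h : torus_sl2 K) (M N : 'M[int]_2).

Lemma ts_ext g h : ts_alpha g = ts_alpha h -> ts_beta g = ts_beta h ->
  ts_mx g = ts_mx h -> g = h.
Proof.
case: g h => [a b M ha hb hM] [a' b' M' ha' hb' hM'] /= ea eb eM; subst.
by congr TorusSL2; exact: Prop_irrelevance.
Qed.

Definition ts_sl2 M (hM : \det M = 1) : torus_sl2 K :=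
  TorusSL2 (oner_neq0 K) (oner_neq0 K) hM.

Lemma ts_mul_sl2 M N hM hN hMN :
  ts_mul (@ts_sl2 M hM) (@ts_sl2 N hN) = @ts_sl2 (M *m N) hMN.
Proof. by apply: ts_ext; rewrite //= !exp1rz !mul1r. Qed.

Lemma ts_split g : g =
  ts_mul (ts_torus (ts_alpha_neq0 g) (ts_beta_neq0 g)) (ts_sl2 (ts_det g)).
Proof. by apply: ts_ext; rewrite /= ?exp1rz ?mulr1 ?mul1mx. Qed.

Lemma mx2_mul (a b c d a' b' c' d' : int) : mx2 a b c d *m mx2 a' b' c' d' =
  mx2 (a * a' + b * c') (a * b' + b * d') (c * a' + d * c') (c * b' + d * d').
Proof.
apply/matrixP=> i j; rewrite !mxE !big_ord_recl big_ord0 !mxE /= addr0.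
by case: ifP; case: ifP.
Qed.

Lemma mx2_det (a b c d : int) : \det (mx2 a b c d) = a * d - b * c.
Proof.
rewrite (expand_det_row _ 0) !big_ord_recl big_ord0 /cofactor !det_mx11 !mxE /=.
by rewrite !expr0 !expr1 mul1r addr0 mulN1r mulrN.
Qed.

Lemma mx2_eta M : M = mx2 (M 0 0) (M 0 1) (M 1 0) (M 1 1).
Proof.
by apply/matrixP=> -[[|[|//]] hi] [[|[|//]] hj]; rewrite mxE /=; congr (M _ _);
  exact: val_inj.
Qed.

Section Induction.
Variable G : torus_sl2 K -> Prop.
Hypothesis GM : forall g h, G g -> G h -> G (ts_mul g h).
Hypothesis GV : forall g h, ts_mul h g = ts_one K -> G g -> G h.
Hypothesis GT : forall a b (ha : a != 0) (hb : b != 0), G (ts_torus ha hb).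
Hypotheses (G1 : G (ts_g1 K)) (G2 : G (ts_g2 K)).

(** Quantifying over the proof of the determinant condition allows the matrix to be rewritten. *)
Let P M := forall hM, G (@ts_sl2 M hM).

Let P_eq M (hM hM' : \det M = 1) : G (ts_sl2 hM) -> G (ts_sl2 hM').
Proof. by rewrite (Prop_irrelevance hM hM'). Qed.

Let step N N' M : \det N = 1 -> N' *m N = 1%:M -> P N' -> P (N *m M) -> P M.
Proof.
move=> dN NN PN' PNM hM.
have dNM : \det (N *m M) = 1 by rewrite det_mulmx dN hM mulr1.
have dN' : \det N' = 1.
  by have := congr1 (fun B => \det B) NN; rewrite det_mulmx dN det1 mulr1.
have E : N' *m (N *m M) = M by rewrite mulmxA NN mul1mx.
have hM' : \det (N' *m (N *m M)) = 1 by rewrite E.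
have := GM (PN' dN') (PNM dNM); rewrite (ts_mul_sl2 dN' dNM hM').
move: hM'; rewrite E => hM'; exact: P_eq.
Qed.

Let Pinv N N' : \det N = 1 -> N' *m N = 1%:M -> P N -> P N'.
Proof.
move=> dN NN PN dN'; apply: (GV _ (PN dN)).
have h : \det (N' *m N) = 1 by rewrite NN det1.
by rewrite (ts_mul_sl2 dN' dN h); apply: ts_ext.
Qed.

Let P1 : P (mx2 1 1 0 1). Proof. by move=> h; exact: P_eq G1. Qed.
Let P2 : P (mx2 1 0 (-1) 1). Proof. by move=> h; exact: P_eq G2. Qed.

Let mx2_1 : mx2 1 0 0 1 = 1%:M.
Proof. by apply/matrixP=> -[[|[|//]] hi] [[|[|//]] hj]; rewrite !mxE. Qed.

Let P1V : P (mx2 1 (-1) 0 1).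
Proof. by apply: (Pinv _ _ P1); rewrite ?mx2_det // mx2_mul -mx2_1. Qed.

Let P2V : P (mx2 1 0 1 1).
Proof. by apply: (Pinv _ _ P2); rewrite ?mx2_det // mx2_mul -mx2_1. Qed.

Let row1D a b c d : P (mx2 (a + c) (b + d) c d) -> P (mx2 a b c d).
Proof.
move=> h; apply: (step (N := mx2 1 1 0 1) _ _ P1V).
- by rewrite mx2_det.
- by rewrite mx2_mul -mx2_1.
- by rewrite mx2_mul !mul1r !mul0r !add0r.
Qed.

Let row1B a b c d : P (mx2 (a - c) (b - d) c d) -> P (mx2 a b c d).
Proof.
move=> h; apply: (step (N := mx2 1 (-1) 0 1) _ _ P1).
- by rewrite mx2_det.
- by rewrite mx2_mul -mx2_1.
- by rewrite mx2_mul !mul1r !mulN1r !mul0r !add0r.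
Qed.

Let row2D a b c d : P (mx2 a b (c + a) (d + b)) -> P (mx2 a b c d).
Proof.
move=> h; apply: (step (N := mx2 1 0 1 1) _ _ P2).
- by rewrite mx2_det.
- by rewrite mx2_mul -mx2_1.
- by rewrite mx2_mul !mul1r !mul0r !addr0 [a + c]addrC [b + d]addrC.
Qed.

Let row2B a b c d : P (mx2 a b (c - a) (d - b)) -> P (mx2 a b c d).
Proof.
move=> h; apply: (step (N := mx2 1 0 (-1) 1) _ _ P2V).
- by rewrite mx2_det.
- by rewrite mx2_mul -mx2_1.
- by rewrite mx2_mul !mul1r !mul0r !mulN1r !addr0 [- a + c]addrC [- b + d]addrC.
Qed.

Let P_unip b : P (mx2 1 b 0 1).
Proof.
have P0 : P (mx2 1 0 0 1).
  by apply: row1D; rewrite addr0 add0r; exact: P1.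
case: b => [n|n].
  elim: n => [|n IH] //; apply: row1B; rewrite subr0.
  by have -> : Posz n.+1 - 1 = Posz n by lia.
elim: n => [|n IH]; apply: row1D; rewrite addr0.
  by have -> : Negz 0 + 1 = 0 by lia.
by have -> : Negz n.+1 + 1 = Negz n by lia.
Qed.

Let P_upper a b d : P (mx2 a b 0 d).
Proof.
move=> hM; have := hM; rewrite mx2_det mulr0 subr0 => ad.
have [[a1 d1]|[a1 d1]] : (a = 1 /\ d = 1) \/ (a = -1 /\ d = -1).
  have : (`|a| * `|d| == 1)%N by rewrite -abszM ad.
  rewrite muln_eq1 => /andP[/eqP ha _].
  have aE : a = 1 \/ a = -1 by clear -ha; lia.
  case: aE => aE; rewrite aE ?mul1r ?mulN1r in ad.
    by left; split.
  by right; split=> //; rewrite -ad opprK.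
  by move: hM; rewrite a1 d1; exact: P_unip.
(* The first column runs through (-1, 0), (-1, -1), (0, -1), (1, -1), (1, 0). *)
move: hM; rewrite a1 d1; apply: row2D; apply: row1B; apply: row1B; apply: row2D.
by rewrite [X in P X](_ : _ = mx2 1 (2 - b) 0 1); [exact: P_unip | congr mx2; lia].
Qed.

(** Euclid's algorithm on the first column: if a and c are nonzero, some row operation lowers |a| +
    |c|; a column (0, c) is turned into (c, 0). *)
Let P_mx2 n a b c d : (`|a| + `|c| <= n)%N -> P (mx2 a b c d).
Proof.
elim: n a b c d => [|n IH] a b c d hn.
  have -> : c = 0 by lia.
  exact: P_upper.
case: (eqVneq c 0) => [->|c0]; first exact: P_upper.
case: (eqVneq a 0) => [->|a0].
  by apply: row1D; apply: row2B; rewrite add0r subrr; exact: P_upper.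
have [h|h|h|h] : [\/ (`|(a - c)%R| + `|c| <= n)%N, (`|(a + c)%R| + `|c| <= n)%N,
    (`|a| + `|(c - a)%R| <= n)%N | (`|a| + `|(c + a)%R| <= n)%N].
  have [h|[h|[h|h]]] : (`|(a - c)%R| + `|c| <= n)%N
      \/ (`|(a + c)%R| + `|c| <= n)%N \/ (`|a| + `|(c - a)%R| <= n)%N
      \/ (`|a| + `|(c + a)%R| <= n)%N by lia.
  - by constructor 1.
  - by constructor 2.
  - by constructor 3.
  - by constructor 4.
- by apply: row1B; exact: IH.
- by apply: row1D; exact: IH.
- by apply: row2B; exact: IH.
- by apply: row2D; exact: IH.
Qed.

Lemma torus_sl2_ind g : G g.
Proof.
rewrite (ts_split g); apply: GM; first exact: GT.
have h := @P_mx2 _ (ts_mx g 0 0) (ts_mx g 0 1) _ (ts_mx g 1 1) (leqnn _).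
by have := h (ts_mx g 1 0); rewrite -mx2_eta; apply.
Qed.

End Induction.
End TorusSL2.

(** * Scalings by powers of q are inner *)

Section Inner.
Variables (K : closedFieldType) (q : K) (A : unitAlgType K) (x y : A).
Hypotheses (q0 : q != 0) (xy : quantum_gen q x y).

Definition inner_scaling a b := exists2 w : A, w \is a GRing.unit &
  w * x * w^-1 = a *: x /\ w * y * w^-1 = b *: y.

Lemma inner_scalingM a b a' b' : inner_scaling a b -> inner_scaling a' b' ->
  inner_scaling (a * a') (b * b').
Proof.
case=> w uw [wx wy] [w' uw' [wx' wy']]; exists (w * w'); first by rewrite unitrMl.
have e t c c' : w * t * w^-1 = c *: t -> w' * t * w'^-1 = c' *: t ->
    w * w' * t * (w * w')^-1 = (c * c') *: t.
  move=> h h'; rewrite invrM // mulrA -(mulrA w w') -(mulrA w (w' * t)) h'.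
  by rewrite -scalerAr -scalerAl h scalerA mulrC.
by split; exact: e.
Qed.

Lemma inner_scalingV a b : a != 0 -> b != 0 -> inner_scaling a b ->
  inner_scaling a^-1 b^-1.
Proof.
move=> a0 b0 [w uw [wx wy]]; exists w^-1; first by rewrite unitrV.
have e t c : c != 0 -> w * t * w^-1 = c *: t -> w^-1 * t * w^-1^-1 = c^-1 *: t.
  move=> c0 h; rewrite invrK; apply: (scalerI c0); rewrite scalerA divff //.
  by rewrite scale1r scalerAl scalerAr -h !mulrA mulVr // mul1r mulrVK.
by split; exact: e.
Qed.

Lemma inner_scalingX a b (k : int) : a != 0 -> b != 0 -> inner_scaling a b ->
  inner_scaling (a ^ k) (b ^ k).
Proof.
move=> a0 b0 ab; have pos (n : nat) : inner_scaling (a ^+ n) (b ^+ n).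
  elim: n => [|n IH]; last by rewrite !exprS; exact: inner_scalingM.
  by exists 1; [exact: unitr1 | rewrite !expr0 !scale1r !mul1r invr1 !mulr1].
case: k => n; first exact: pos.
by apply: inner_scalingV (pos n.+1); rewrite expf_neq0.
Qed.

(** Conjugation by [y] scales [x] by q^-1 and fixes [y]; conjugation by [x] fixes [x] and scales [y]
    by q. Hence the exponents -k and m. *)
Lemma inner_scaling_q (k m : int) : inner_scaling (q ^ k) (q ^ m).
Proof.
have [ux uy cxy _] := xy.
have hx : inner_scaling q^-1 1.
  exists y => //; rewrite scale1r mulrK //; split=> //; apply: (mulIr uy).
  by rewrite mulrVK // -scalerAl cxy scalerA mulVf // scale1r.
have hy : inner_scaling 1 q.
  exists x => //; rewrite scale1r mulrK //; split=> //; apply: (mulIr ux).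
  by rewrite mulrVK // cxy -scalerAl.
have q'0 : q^-1 != 0 by rewrite invr_eq0.
have := inner_scalingM (inner_scalingX (- k) q'0 (oner_neq0 K) hx)
  (inner_scalingX m (oner_neq0 K) q0 hy).
by rewrite !exp1rz mulr1 mul1r exprz_inv opprK.
Qed.

End Inner.

(** * Equivariance of omega *)

Section Equivariance.
Local Open Scope quotient_scope.
Variables (K : closedFieldType) (q : K) (A : unitAlgType K) (x y : A).
Variables (Q : unitRingType) (iota : {rmorphism A -> Q}).
Hypotheses (q0 : q != 0) (hq : forall n, (0 < n)%N -> q ^+ n != 1).
Hypotheses (hQ : quotient_skewfield iota) (hA : quantum_torus q x y).
Local Notation CMmod := (CMmod iota).

Let xy : quantum_gen q x y := quantum_torus_gen hA.

Definition point_mod n (d : CM q n) : lmodType A^c := CMmod x y (repr d).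

Lemma point_mod_pi n (z : cmquad q n) :
  lmod_iso (CMmod x y z) (point_mod (\pi_(CM q n) z)).
Proof.
rewrite /point_mod; case: piP => z' /eqmodP /asboolP.
exact: CMmod_gauge.
Qed.

(** A conjugation rescales (x, y) by (q^-k, q^-m) within the isomorphism class; [CMmod_scale] then
    moves this onto the quadruple, with inverse factors (q^k, q^m). *)
Lemma point_mod_z2 n (d : CM q n) (k m : int) :
  lmod_iso (point_mod d) (point_mod (z2act q0 k m d)).
Proof.
apply: lmod_iso_trans (point_mod_pi _).
have [w uw [wx wy]] := inner_scaling_q q0 xy (- k) (- m).
have ha := expfz_neq0 (- k) q0; have hb := expfz_neq0 (- m) q0.
have := CMmod_conj q0 hq hQ (repr d) xy uw; rewrite wx wy.
move=> h; apply: lmod_iso_trans h _.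
have := CMmod_scale q0 hq hQ ha hb (repr d) xy.
congr (lmod_iso _ (CMmod x y _)).
by apply: cmquad_ext => //=; rewrite -!invr_expz ?opprK // !invrK.
Qed.

Variable phi : torus_sl2 K -> automorphism A.
Hypothesis hphi : aut_identification x y phi.
Variable act : forall n, torus_sl2 K -> CM q n -> CM q n.
Hypothesis hact : CM_action act.

Let aut_fixing (s : automorphism A) : s x = x -> s y = y -> s =1 id.
Proof.
move=> sx sy a.
have [f [_ _ fU]] := qt_univ hA (qt_unit_x hA) (qt_unit_y hA) (qt_comm hA).
have -> : s a = f a by exact: fU.
by rewrite -(fU idfun).
Qed.

(** Induction on generators; [ai_mul] and [ca_mul] both apply g before h, in agreement with the
    composition of semilinear maps. *)
Lemma point_mod_act g n (d : CM q n) :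
  semilinear_iso (phi g) (point_mod d) (point_mod (act g d)).
Proof.
move: g n d; apply: torus_sl2_ind.
- move=> g h IHg IHh n d; rewrite (ca_mul hact).
  apply: eq_semilinear_iso (semilinear_iso_trans (IHg n d) (IHh n _)) => a.
  by rewrite (ai_mul hphi).
- move=> g h hg IHg n d.
  have := IHg n (act h d); rewrite -(ca_mul hact) hg (ca_one hact).
  (* [phi h] is a right inverse of [phi g], because [phi] of the neutral element fixes [x] and [y]
     and so is the identity. *)
  apply: semilinear_iso_sym => a; rewrite -(ai_mul hphi) hg.
  have [tx ty] := ai_torus hphi (oner_neq0 K) (oner_neq0 K).
  by rewrite aut_fixing // ?tx ?ty scale1r.
- move=> a b ha hb n d; set s := phi _.
  have [sx sy] := ai_torus hphi ha hb.
  rewrite -[d in point_mod (act _ d)]reprK (ca_torus hact).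
  apply: (semilinear_iso_lmodr _ (point_mod_pi _)).
  apply: (semilinear_iso_lmodr (CMmod_aut q0 hq hQ s (repr d) xy)).
  by rewrite sx sy; exact: CMmod_scale.
- move=> n d; set s := phi _; have [sx sy] := ai_g1 hphi.
  rewrite -[d in point_mod (act _ d)]reprK (ca_g1 hact).
  apply: (semilinear_iso_lmodr _ (point_mod_pi _)).
  apply: (semilinear_iso_lmodr (CMmod_aut q0 hq hQ s (repr d) xy)).
  have := quantum_gen_aut s xy; rewrite sx sy => wy; exact: CMmod_g1.
- move=> n d; set s := phi _; have [sx sy] := ai_g2 hphi.
  rewrite -[d in point_mod (act _ d)]reprK (ca_g2 hact).
  apply: (semilinear_iso_lmodr _ (point_mod_pi _)).
  apply: (semilinear_iso_lmodr (CMmod_aut q0 hq hQ s (repr d) xy)).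
  have := quantum_gen_aut s xy; rewrite sx sy => wy; exact: CMmod_g2.
Qed.

Lemma omegaP (c : CMbar q0) :
  lmod_iso (point_mod (repr (tagged c))) (ideal_mod (repr (omega x y iota c))).
Proof.
apply: (class_of_moduleP (I := NzIdeal (cm_ideal_nz q0 hq hQ _ xy))).
exact: CMmod_ideal.
Qed.

Lemma omega_equivariant g (c : CMbar q0) : semilinear_iso (phi g)
  (ideal_mod (repr (omega x y iota c)))
  (ideal_mod (repr (omega x y iota (act_bar act g c)))).
Proof.
apply: (semilinear_iso_lmodl (lmod_iso_sym (omegaP c))).
apply: (semilinear_iso_lmodr (point_mod_act g _)).
apply: lmod_iso_trans (omegaP _); rewrite /act_bar /=.
case: piP => d /eqmodP /asboolP[k [m ->]]; exact: point_mod_z2.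
Qed.

End Equivariance.

Theorem proposition2 (R : realType) (q : R[i]) (hq0 : q != 0)
  (hq : forall n : nat, (0 < n)%N -> q ^+ n != 1)
  (A : unitAlgType R[i]) (x y : A) (hA : quantum_torus q x y)
  (Q : unitRingType) (iota : {rmorphism A -> Q})
  (hQ : quotient_skewfield iota)
  (phi : torus_sl2 R[i] -> automorphism A)
  (hphi : aut_identification x y phi)
  (act : forall n : nat, torus_sl2 R[i] -> CM q n -> CM q n)
  (hact : CM_action act)
  (P : bimodule A) (hP : invertible_bimod P)
  (c c' : CMbar hq0) :
  pic_act_CM phi act P c c' ->
  pic_act_R P (omega x y iota c) (omega x y iota c').
Proof.
case=> g [Pg ->]; apply: pic_act_R_twist Pg _.
exact: (@omega_equivariant R[i] q A x y Q iota hq0 hq hQ hA phi hphi act hact).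
Qed.
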